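(* Let $r,c$ be positive integers with $r>1$. Let $G=N_{r,c}=F_r/\gamma_{c+1}(F_r)$ or $G=M_{r,c}=F_r/\big(\gamma_{c+1}(F_r)F_r^{(2)}\big)$. Then $G$ has property $R_\infty$ if and only if $c\geq 2r$.
   Context: For a group $G$ and an endomorphism $\varphi$ of $G$, elements $x,y\in G$ are Reidemeister equivalent if there is $z\in G$ with $x=zy\varphi(z)^{-1}$. The Reidemeister number $R(\varphi)\in\{1,2,3,\ldots\}\cup\{\infty\}$ is the number of equivalence classes. A group $G$ has property $R_\infty$ if $R(\varphi)=\infty$ for every automorphism $\varphi$ of $G$. $F_r$ is the free group on $r$ generators. For a group $G$, the lower central series is $\gamma_1(G)=G$, $\gamma_{i+1}(G)=[\gamma_i(G),G]$, and the derived series is $G^{(0)}=G$, $G^{(i+1)}=[G^{(i)},G^{(i)}]$. Thus $N_{r,c}$ is the free nilpotent group of class $c$ and rank $r$, and $M_{r,c}$ is the free $c$-step nilpotent and metabelian group of rank $r$. *)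

(* Defs.v *)
From HB Require Import structures.
From mathcomp Require Import all_boot finmap.
From mathcomp Require Import boolp classical_sets cardinality.

Set Implicit Arguments.
Unset Strict Implicit.
Unset Printing Implicit Defensive.

Local Open Scope classical_set_scope.
Local Open Scope group_scope.

(* The groups here are infinite: they live in the groupType structure of
   monoid.v, and subgroups are classical sets. *)

Section FreeGroup.
Variable T : choiceType.

(* (x, true) stands for the generator x and (x, false) for its inverse. *)
Definition letterV (a : T * bool) : T * bool := (a.1, ~~ a.2).

Definition reduced (w : seq (T * bool)) : bool :=
  sorted (fun a b => b != letterV a) w.

(* Reduced form of a :: w, for w reduced. *)
Definition push (a : T * bool) (w : seq (T * bool)) : seq (T * bool) :=
  if w is b :: w' then if b == letterV a then w' else a :: w else [:: a].

(* Reduced form of u ++ v, for v reduced. *)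
Definition word_mul (u v : seq (T * bool)) : seq (T * bool) := foldr push v u.

Definition word_inv (w : seq (T * bool)) : seq (T * bool) :=
  rev (map letterV w).

Lemma letterVK : involutive letterV.
Proof. by case=> x b; rewrite /letterV /= negbK. Qed.

Lemma reduced_behead a w : reduced (a :: w) -> reduced w.
Proof. by case: w => //= b w /andP[]. Qed.

Lemma reduced_push a w : reduced w -> reduced (push a w).
Proof.
case: w => //= b w rw; case: eqVneq => [_|nab].
  exact: reduced_behead rw.
by rewrite /= nab.
Qed.

Lemma reduced_mul u v : reduced v -> reduced (word_mul u v).
Proof. by move=> rv; elim: u => //= a u; apply: reduced_push. Qed.

Lemma pushK a w : reduced w -> push a (push (letterV a) w) = w.
Proof.
case: w => [_|b w rw] /=; first by rewrite eqxx.
rewrite letterVK; case: eqVneq rw => [->|_ _]; last by rewrite /= eqxx.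
by case: w => //= c w /andP[/negPf ->].
Qed.

Lemma word_mul_push a t w :
  reduced w -> word_mul (push a t) w = push a (word_mul t w).
Proof.
case: t => //= b t rw; case: eqVneq => // -> /=.
by rewrite pushK // reduced_mul.
Qed.

Lemma word_mulA u v w :
  reduced w -> word_mul u (word_mul v w) = word_mul (word_mul u v) w.
Proof. by move=> rw; elim: u => //= a u ->; rewrite word_mul_push. Qed.

Lemma word_mul1 w : reduced w -> word_mul w [::] = w.
Proof.
elim: w => //= a w IHw rw; rewrite IHw ?(reduced_behead rw) //.
by case: w rw {IHw} => //= b w /andP[/negPf ->].
Qed.

Lemma word_mulV w : word_mul (word_inv w) w = [::].
Proof.
rewrite /word_inv; elim: w => //= a w IHw.
by rewrite rev_cons /word_mul foldr_rcons /= letterVK eqxx.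
Qed.

Lemma reduced_inv w : reduced w -> reduced (word_inv w).
Proof.
rewrite /reduced /word_inv rev_sorted sorted_map; apply: sub_sorted => a b /=.
by apply: contraNN => /eqP ->; rewrite letterVK.
Qed.

Lemma word_invK : involutive word_inv.
Proof.
by move=> w; rewrite /word_inv map_rev revK -map_comp (eq_map letterVK) map_id.
Qed.

Record free_group : Type :=
  FreeGroup { fword :> seq (T * bool); _ : reduced fword }.

HB.instance Definition _ := [isSub for fword].
HB.instance Definition _ := [Choice of free_group by <:].

Lemma fwordP (x : free_group) : reduced x. Proof. exact: valP. Qed.

Definition free_one : free_group := @FreeGroup [::] isT.
Definition free_mul (x y : free_group) : free_group :=
  FreeGroup (reduced_mul x (fwordP y)).
Definition free_inv (x : free_group) : free_group :=
  FreeGroup (reduced_inv (fwordP x)).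

Fact free_mulA : associative free_mul.
Proof. by move=> x y z; apply/val_inj/word_mulA/fwordP. Qed.
Fact free_mul1g : left_id free_one free_mul.
Proof. by move=> x; apply/val_inj. Qed.
Fact free_mulg1 : right_id free_one free_mul.
Proof. by move=> x; apply/val_inj/word_mul1/fwordP. Qed.
Fact free_mulVg : left_inverse free_one free_inv free_mul.
Proof. by move=> x; apply/val_inj/word_mulV. Qed.
Fact free_mulgV : right_inverse free_one free_inv free_mul.
Proof. by move=> x; apply/val_inj; rewrite /= -{1}(word_invK x) word_mulV. Qed.

HB.instance Definition _ := isGroup.Build free_group
  free_mulA free_mul1g free_mulg1 free_mulVg free_mulgV.

End FreeGroup.

(* Rewriting with mulgA leaves a reverse_coercion in the goal that blocks
   later rewrites; this restatement does not. *)
Lemma mulgAg (G : groupType) (x y z : G) : x * (y * z) = x * y * z.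
Proof. exact: mulgA. Qed.

Section Subgroups.
Variable G : groupType.
Implicit Types H K A : set G.

Definition is_subgroup H : Prop := H 1 /\ forall x y, H x -> H y -> H (x / y).

Definition is_normal_subgroup H : Prop :=
  is_subgroup H /\ forall x y, H x -> H (x ^ y).

Definition generated A : set G := smallest is_subgroup A.

Definition commutator_subgroup H K : set G :=
  generated [set [~ x, y] | x in H & y in K].

(* Indexed from 1: lower_central 0 is a junk value. *)
Definition lower_central (n : nat) : set G :=
  iter n.-1 (fun H => commutator_subgroup H setT) setT.

Definition derived (n : nat) : set G :=
  iter n (fun H => commutator_subgroup H H) setT.

Definition product_set H K : set G := [set x * y | x in H & y in K].

Lemma subgroupM H x y : is_subgroup H -> H x -> H y -> H (x * y).
Proof.
move=> [H1 HF] Hx Hy; rewrite -[y]invgK; apply: (HF) => //.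
by rewrite -[_^-1]mul1g; exact: HF.
Qed.

Lemma generated_subgroup A : is_subgroup (generated A).
Proof.
split=> [M [[]]//|x y Ax Ay M [MG AM]].
by apply: MG.2; [apply: Ax|apply: Ay].
Qed.

Lemma generated_normal A :
  (forall x y, A x -> A (x ^ y)) -> is_normal_subgroup (generated A).
Proof.
move=> AJ; split=> [|x y Ax M [[M1 MF] AM]]; first exact: generated_subgroup.
apply: (Ax [set z | M (z ^ y)]); split=> [|z Az]; last exact/AM/AJ.
split=> /= [|u v Mu Mv]; first by rewrite conj1g.
by rewrite conjMg conjVg; apply: MF.
Qed.

Lemma commutator_normal H K : is_normal_subgroup H -> is_normal_subgroup K ->
  is_normal_subgroup (commutator_subgroup H K).
Proof.
move=> [_ HJ] [_ KJ]; apply: generated_normal => _ z [x Hx [y Ky <-]].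
by exists (x ^ z); [exact: HJ|exists (y ^ z); [exact: KJ|rewrite -conjRg]].
Qed.

Lemma lower_central_normal n : is_normal_subgroup (lower_central n).
Proof.
rewrite /lower_central; elim: n.-1 => [|m IHm] //=.
exact/commutator_normal.
Qed.

Lemma derived_normal n : is_normal_subgroup (derived n).
Proof. by elim: n => [|m IHm] //=; exact: commutator_normal. Qed.

Lemma product_normal H K : is_normal_subgroup H -> is_normal_subgroup K ->
  is_normal_subgroup (product_set H K).
Proof.
move=> [HG HJ] [KG KJ]; split; first split.
- by exists 1; [exact: HG.1|exists 1; [exact: KG.1|rewrite mulg1]].
- move=> _ _ [x Hx [y Ky <-]] [x' Hx' [y' Ky' <-]].
  exists (x / x'); first exact: HG.2.
  exists ((y / y') ^ x'^-1); first by apply: KJ; exact: KG.2.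
  by rewrite /conjg invgK invgM !mulgAg mulgVK.
- move=> _ z [x Hx [y Ky <-]].
  by exists (x ^ z); [exact: HJ|exists (y ^ z); [exact: KJ|rewrite conjMg]].
Qed.

End Subgroups.

Section Quotient.
Variables (G : groupType) (N : set G) (nN : is_normal_subgroup N).
Local Open Scope quotient_scope.

Definition congr_mod (x y : G) : bool := `[< N (x^-1 * y) >].

Fact congr_mod_refl : reflexive congr_mod.
Proof. by move=> x; apply/asboolP; rewrite mulVg; exact: nN.1.1. Qed.

Fact congr_mod_sym : symmetric congr_mod.
Proof.
suff sym x y : congr_mod x y -> congr_mod y x.
  by move=> x y; apply/idP/idP; exact: sym.
move=> /asboolP Nxy; apply/asboolP.
have -> : y^-1 * x = 1 / (x^-1 * y) by rewrite div1g invgM invgK.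
exact: (nN.1.2 _ _ nN.1.1).
Qed.

Fact congr_mod_trans : transitive congr_mod.
Proof.
move=> y x z /asboolP Nxy /asboolP Nyz; apply/asboolP.
have -> : x^-1 * z = (x^-1 * y) * (y^-1 * z) by rewrite mulgAg mulgK.
exact: subgroupM nN.1 _ _.
Qed.

Definition congr_mod_equiv : equiv_rel G :=
  EquivRel congr_mod congr_mod_refl congr_mod_sym congr_mod_trans.

Definition quotient_group : Type := {eq_quot congr_mod_equiv}.

HB.instance Definition _ := Choice.on quotient_group.
HB.instance Definition _ := EqQuotient.on quotient_group.

Definition coset_mod (x : G) : quotient_group := \pi_quotient_group x.
Definition coset_repr (a : quotient_group) : G := repr a.

Definition quotient_one : quotient_group := coset_mod 1.
Definition quotient_mul (a b : quotient_group) : quotient_group :=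
  coset_mod (coset_repr a * coset_repr b).
Definition quotient_inv (a : quotient_group) : quotient_group :=
  coset_mod (coset_repr a)^-1.

Lemma coset_reprK : cancel coset_repr coset_mod.
Proof. exact: reprK. Qed.

Lemma eq_coset_mod (x y : G) : coset_mod x = coset_mod y <-> N (x^-1 * y).
Proof. by split=> [/eqmodP/asboolP|Nxy]; last exact/eqmodP/asboolP. Qed.

Lemma repr_coset_mod x : exists2 n, N n & coset_repr (coset_mod x) = x * n.
Proof.
exists (x^-1 * coset_repr (coset_mod x)); last by rewrite mulgAg mulgV mul1g.
by apply/eq_coset_mod; rewrite coset_reprK.
Qed.

Lemma quotient_mulE x y :
  quotient_mul (coset_mod x) (coset_mod y) = coset_mod (x * y).
Proof.
have [m Nm ex] := repr_coset_mod x; have [n Nn ey] := repr_coset_mod y.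
rewrite /quotient_mul ex ey; apply/esym/eq_coset_mod.
have -> : (x * y)^-1 * (x * m * (y * n)) = m ^ y * n.
  by rewrite invgM /conjg !mulgAg mulgVK.
by apply: subgroupM nN.1 _ Nn; exact: nN.2.
Qed.

Lemma quotient_invE x : quotient_inv (coset_mod x) = coset_mod x^-1.
Proof.
rewrite /quotient_inv; have [m Nm ->] := repr_coset_mod x.
apply/eq_coset_mod.
have -> : (x * m)^-1^-1 * x^-1 = m ^ x^-1 by rewrite /conjg !invgK mulgAg.
exact: nN.2.
Qed.

Fact quotient_mulA : associative quotient_mul.
Proof.
move=> a b c; rewrite -(coset_reprK a) -(coset_reprK b) -(coset_reprK c).
by rewrite 2!quotient_mulE (quotient_mulE (coset_repr a)) quotient_mulE mulgAg.
Qed.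
Fact quotient_mul1g : left_id quotient_one quotient_mul.
Proof. by move=> a; rewrite -(coset_reprK a) quotient_mulE mul1g. Qed.
Fact quotient_mulg1 : right_id quotient_one quotient_mul.
Proof. by move=> a; rewrite -(coset_reprK a) quotient_mulE mulg1. Qed.
Fact quotient_mulVg : left_inverse quotient_one quotient_inv quotient_mul.
Proof.
by move=> a; rewrite -(coset_reprK a) quotient_invE quotient_mulE mulVg.
Qed.
Fact quotient_mulgV : right_inverse quotient_one quotient_inv quotient_mul.
Proof.
by move=> a; rewrite -(coset_reprK a) quotient_invE quotient_mulE mulgV.
Qed.

HB.instance Definition _ := isGroup.Build quotient_group
  quotient_mulA quotient_mul1g quotient_mulg1 quotient_mulVg quotient_mulgV.

Fact coset_mod_morph : {morph coset_mod : x y / x * y}.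
Proof. by move=> x y; exact/esym/quotient_mulE. Qed.

HB.instance Definition _ := isMultiplicative.Build G quotient_group coset_mod
  coset_mod_morph.

End Quotient.

Section Reidemeister.
Variable G : groupType.
Implicit Types phi : {multiplicative G -> G}.

Definition reidemeister_equiv phi (x y : G) : Prop :=
  exists z : G, x = z * y * (phi z)^-1.

Definition reidemeister_classes phi : set (set G) :=
  range (fun y => [set x | reidemeister_equiv phi x y]).

(* None stands for infinity. *)
Definition reidemeister_number phi : option nat :=
  if `[< finite_set (reidemeister_classes phi) >]
  then Some #|` fset_set (reidemeister_classes phi)|%fset else None.

Definition R_infinity : Prop :=
  forall phi, bijective phi -> reidemeister_number phi = None.

End Reidemeister.
Arguments R_infinity G : clear implicits.

Definition free_group_rank (r : nat) : groupType :=
  Group.clone (free_group 'I_r) _.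

Definition free_nilpotent (r c : nat) : groupType :=
  let F := free_group_rank r in
  Group.clone (quotient_group (lower_central_normal F c.+1)) _.

Definition free_nilpotent_metabelian (r c : nat) : groupType :=
  let F := free_group_rank r in
  Group.clone (quotient_group
    (product_normal (lower_central_normal F c.+1) (derived_normal F 2))) _.

(* Main.v *)
Require Import Defs.
From mathcomp Require Import all_boot.
From HB Require Import structures.
From mathcomp Require Import all_order all_algebra all_field.
From mathcomp Require Import boolp classical_sets functions cardinality.
From mathcomp Require Import mxtens spectral ring zify.

Set Implicit Arguments.
Unset Strict Implicit.
Unset Printing Implicit Defensive.

Import Order.TTheory GRing.Theory Num.Theory.

(** Let [F] be free of rank [r], let [N] be the kernel of [F -> G], and lift an
automorphism of [G] to an endomorphism [f] of [F], with abelianization the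
integer matrix [A].  Two elements [x], [y] of [F] have equivalent images when
[x = z * y * (f z)^-1 * n] for some [z] in [F] and [n] in [N].  On a central
factor of a filtration this relation is congruence modulo the image of
[1 - f], so everything turns on whether [f] has the eigenvalue 1 there, and
on the factor of weight [k] the eigenvalues of [f] are products of [k]
eigenvalues of [A].  Their total product [det A] is 1 or -1.

If [c < 2r], it suffices to find [A] for which no product of fewer than [2r]
eigenvalues is 1.  A companion matrix is induced by an explicit automorphism
of [F].  The condition on products says that an integer polynomial in the
entries of its last row does not vanish, and rationally such rows exist: take
distinct primes and minus the inverse of their product as eigenvalues.  A
generic integral multiple of such a row, with the constant coefficient kept,
still works ([exists_companion]).  The factors of the lower central series are
spanned by iterated commutators of the generators, on which [f] acts through
tensor powers of [A]; hence [1 - f] has a finite cokernel on each of them and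
the twisted classes are finite in number ([finite_twisted_classes]).

If [c >= 2r], the weight [2r] contains the eigenvalue [(det A)^2 = 1], already
in the metabelian quotient.  This is made concrete without computing the
factors.  A word in [F] is a walk in [Z^r]; choosing a linear form [xi] turns
it into a walk in [C], along which a polynomial [q i] is summed over the steps
parallel to the [i]-th axis.  The sums of polynomials of degree less than [n]
vanish on a subgroup [deep n] which contains [gamma_(n+1)(F)] and [F''] and is
stable under every endomorphism of [F].  The sums in degree [n] embed
[deep n / deep n.+1] into functions homogeneous of degree [n] in [xi] and linear
in a second form [eta], and there [f] acts by substitution of [A].  Call
[top_space n] the complex span of the image.  If the Reidemeister number is
finite, induction on [n < 2r] shows that [f] has no nonzero fixed vector in
[top_space n] ([no_fixed_top]): a fixed element of [F] modulo [deep n] is then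
trivial, so finitely many classes force [1 - f] to be onto in degree [n], hence
injective.  But [top_space (2r - 1)] does have a fixed vector
([top_space_has_fixed]): relative to a basis that makes [A] triangular, filter
the images of commutators by the sum of the indices of their entries; the
commutator in which every basis vector occurs twice is an eigenvector for
[(det A)^2] modulo lower weight. *)

(** * Endomorphisms of finite-dimensional subspaces *)

Section FiniteDimension.
Local Open Scope ring_scope.
Variables (C : fieldType) (V : lmodType C) (S : V -> Prop).
Hypothesis S0 : S 0.
Hypothesis SP : forall a u v, S u -> S v -> S (a *: u + v).

Let S_sum n (a : 'I_n -> C) (t : 'I_n -> V) :
  (forall i, S (t i)) -> S (\sum_i a i *: t i).
Proof. by move=> St; elim/big_rec: _ => // i v _ Sv; exact: SP. Qed.

Definition in_span n (b : 'I_n -> V) v := exists u : 'rV_n, v = \sum_i u 0 i *: b i.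

Definition free_family n (t : 'I_n -> V) :=
  forall u : 'rV_n, \sum_i u 0 i *: t i = 0 -> u = 0.

Lemma free_family_size m (b : 'I_m -> V) n (t : 'I_n -> V) :
  (forall i, in_span b (t i)) -> free_family t -> (n <= m)%N.
Proof.
move=> tb ft; have [u uE] := choice tb.
pose M := \matrix_i u i.
rewrite leqNgt; apply/negP => lt_mn.
have : row_free M.
  rewrite -kermx_eq0; apply/eqP/row_matrixP => i; rewrite row0.
  apply: ft; transitivity (\sum_j (row i (kermx M) *m M) 0 j *: b j).
    under eq_bigr => k _ do rewrite uE scaler_sumr.
    rewrite exchange_big; apply: eq_bigr => j _; rewrite mxE scaler_suml.
    by apply: eq_bigr => k _; rewrite scalerA !mxE.
  by rewrite -row_mul mulmx_ker row0 big1 // => j _; rewrite mxE scale0r.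
rewrite /row_free => /eqP rM; have := rank_leq_col M; rewrite rM.
by rewrite leqNgt lt_mn.
Qed.

(** A free family in [S] of maximal size, which exists because the size is
bounded by the number of vectors that span [S]. *)
Lemma subspace_basis m (b : 'I_m -> V) : (forall v, S v -> in_span b v) ->
  exists n (t : 'I_n -> V),
    [/\ forall i, S (t i), free_family t & forall v, S v -> in_span t v].
Proof.
move=> Sb; pose P n := `[< exists2 t : 'I_n -> V, forall i, S (t i) & free_family t >].
have exP : exists n, P n.
  exists 0%N; apply/asboolP; exists (fun=> 0) => // u _.
  by apply/rowP; case.
have ubP n : P n -> (n <= m)%N.
  move=> /asboolP[t St ft]; apply: free_family_size ft.
  by move=> i; apply: Sb.
case: (ex_maxnP exP ubP) => n /asboolP[t St ft] nmax; exists n, t; split=> // v Sv.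
apply: contrapT => Nv; suff : P n.+1 by move/nmax; rewrite ltnn.
apply/asboolP; exists (fun i => if unlift ord0 i is Some j then t j else v).
  by move=> i; case: unliftP => [j|] _.
move=> u; rewrite big_ord_recl unlift_none.
under eq_bigr => i _ do rewrite liftK.
move=> u0; have u00 : u 0 0 = 0.
  apply: contrapT => /eqP un0; apply: Nv.
  exists (\row_i (- (u 0 0)^-1 * u 0 (lift ord0 i))).
  have /(congr1 (fun x => (u 0 0)^-1 *: x)) := u0.
  rewrite scalerDr scalerA mulVf // scale1r scaler0 => /eqP; rewrite addr_eq0 => /eqP ->.
  rewrite scaler_sumr -sumrN; apply: eq_bigr => i _.
  by rewrite mxE scalerA mulNr scaleNr.
have : \row_i u 0 (lift ord0 i) = 0.
  apply: ft; rewrite -[RHS]u0 u00 scale0r add0r.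
  by apply: eq_bigr => i _; rewrite mxE.
move=> /rowP ul; apply/rowP => i; rewrite [RHS]mxE.
by case: (unliftP ord0 i) => [j ->|-> //]; have := ul j; rewrite !mxE.
Qed.

Variable g : V -> V.
Hypothesis gP : forall a u v, g (a *: u + v) = a *: g u + g v.
Hypothesis gS : forall v, S v -> S (g v).

Let g0 : g 0 = 0.
Proof. by have := gP (-1) 0 0; rewrite scaler0 addr0 scaleN1r addNr. Qed.

Let g_sum n (a : 'I_n -> C) (t : 'I_n -> V) :
  g (\sum_i a i *: t i) = \sum_i a i *: g (t i).
Proof.
elim: n a t => [|n IHn] a t; first by rewrite !big_ord0.
by rewrite !big_ord_recl gP IHn.
Qed.

(** Rank-nullity for a subspace given only as a predicate: in a basis of [S] the
endomorphism [g] is a square matrix. *)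
Lemma stable_inj_surj m (b : 'I_m -> V) : (forall v, S v -> in_span b v) ->
  (forall v, S v -> g v = 0 -> v = 0) <->
  (forall v, S v -> exists2 w, S w & g w = v).
Proof.
move=> /subspace_basis[n [t [St ft spt]]].
have [u uE] := choice (fun i => spt _ (gS (St i))).
pose M := \matrix_i u i.
have gE (a : 'rV_n) :
    g (\sum_i a 0 i *: t i) = \sum_j (a *m M) 0 j *: t j.
  rewrite g_sum; under eq_bigr => i _ do rewrite uE scaler_sumr.
  rewrite exchange_big; apply: eq_bigr => j _; rewrite mxE scaler_suml.
  by apply: eq_bigr => i _; rewrite scalerA !mxE.
have sum_inj (a a' : 'rV_n) :
    \sum_i a 0 i *: t i = \sum_i a' 0 i *: t i -> a = a'.
  move=> /eqP; rewrite -subr_eq0 -sumrB => /eqP aa'; apply/eqP.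
  rewrite -subr_eq0; apply/eqP/ft; rewrite -[RHS]aa'.
  by apply: eq_bigr => i _; rewrite !mxE scalerBl.
split=> [injg|surjg].
- have uM : M \in unitmx.
    rewrite -row_free_unit -kermx_eq0; apply/eqP/row_matrixP => i; rewrite row0.
    apply: ft; apply: injg; first exact: S_sum.
    rewrite gE -row_mul mulmx_ker row0 big1 // => j _.
    by rewrite mxE scale0r.
  move=> v /spt[a ->]; exists (\sum_i (a *m invmx M) 0 i *: t i).
    exact: S_sum.
  by rewrite gE mulmxKV.
- have exw i : exists a : 'rV_n, a *m M = delta_mx 0 i.
    have [v /spt[a ->] gv] := surjg _ (St i); exists a; apply: sum_inj.
    rewrite -gE gv (bigD1 i) //= mxE !eqxx scale1r big1 ?addr0 // => j ji.
    by rewrite mxE (negPf ji) andbF scale0r.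
  have [w wE] := choice exw.
  have uM : M \in unitmx.
    have : (\matrix_i w i) *m M = 1%:M.
      by apply/row_matrixP => i; rewrite row_mul rowK wE row1.
    by case/mulmx1_unit.
  move=> v /spt[a ->]; rewrite gE => gv0.
  have aM0 : a *m M = 0 by apply: ft.
  have -> : a = 0 by rewrite -(mulmxK uM a) aM0 mul0mx.
  by rewrite big1 // => i _; rewrite mxE scale0r.
Qed.

End FiniteDimension.

(** * Finite cokernels over the integers *)

Section IntegerSpan.
Local Open Scope ring_scope.
Variables (Y : zmodType) (m : nat) (b : 'I_m -> Y).

Definition int_span y := exists u : 'I_m -> int, y = \sum_i b i *~ u i.

Lemma int_spanD y z : int_span y -> int_span z -> int_span (y + z).
Proof.
move=> [u ->] [v ->]; exists (fun i => u i + v i); rewrite -big_split.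
by apply: eq_bigr => i _; rewrite mulrzDr.
Qed.

Lemma int_spanMz y k : int_span y -> int_span (y *~ k).
Proof.
move=> [u ->]; exists (fun i => u i * k); rewrite mulrz_suml.
by apply: eq_bigr => i _; rewrite mulrzA.
Qed.

Lemma int_span0 : int_span 0.
Proof. by exists (fun=> 0); rewrite big1. Qed.

Lemma int_span_sum I (s : seq I) (v : I -> Y) (k : I -> int) :
  (forall i, int_span (v i)) -> int_span (\sum_(i <- s) v i *~ k i).
Proof.
move=> vY; elim/big_rec: _ => [|i y _ Yy]; first exact: int_span0.
exact/int_spanD/Yy/int_spanMz.
Qed.

Lemma mem_int_span i : int_span (b i).
Proof.
exists (fun j => (j == i)%:Z); rewrite (bigD1 i) //= eqxx mulr1z big1 ?addr0 //.
by move=> j /negPf ->; rewrite mulr0z.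
Qed.

End IntegerSpan.

Section FiniteCokernel.
Local Open Scope ring_scope.

(** Multiplying [1 - K] by its adjugate shows that [D * b i] lies in the image of
[1 - h], where [D] is the determinant; reducing the coefficients modulo [D]
leaves finitely many representatives. *)
Lemma finite_coker (Y : zmodType) (h : Y -> Y) m (b : 'I_m -> Y)
    (K : 'M[int]_m) : {morph h : x y / x - y} ->
  (forall y, int_span b y) ->
  (forall i, h (b i) = \sum_j b j *~ K i j) -> \det (1%:M - K) != 0 ->
  exists T : seq Y, forall y, exists2 t, t \in T & exists z, y = t + z - h z.
Proof.
move=> hB gen hb.
have [f fh] : exists f : {additive Y -> Y}, f =1 h.
  pose g : {additive Y -> Y} := HB.pack h (GRing.isZmodMorphism.Build Y Y h hB).
  by exists g.
have fb i : f (b i) = \sum_j b j *~ K i j by rewrite fh hb.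
set D := (\det _) => D0.
pose T := [seq (\sum_i b i *+ c i) | c : {ffun 'I_m -> 'I_`|D|}].
exists T => y.
have [a ->] := gen y.
have lt_mod i : (absz (a i %% D)%Z < absz D)%N.
  by rewrite -ltz_nat gez0_abs ?modz_ge0 // abszE ltz_mod.
exists (\sum_i b i *+ (Ordinal (lt_mod i))).
  apply/fintype.imageP; exists [ffun i => Ordinal (lt_mod i)] => //.
  by apply: eq_bigr => i _; rewrite ffunE.
(* adj (1 - K) * (1 - K) = D *)
have Db i : exists z, (b i *~ D = z - f z).
  exists (\sum_l b l *~ (\adj (1%:M - K)) i l).
  rewrite [f _]raddf_sum -sumrB /=.
  transitivity (\sum_j b j *~ (\adj (1%:M - K) *m (1%:M - K)) i j).
    rewrite mul_adj_mx (bigD1 i) //= !mxE eqxx mulr1n big1 ?addr0 // => j ji.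
    by rewrite !mxE eq_sym (negPf ji) mulr0n mulr0z.
  rewrite (eq_bigr (fun j => \sum_l b j *~
    ((\adj (1%:M - K)) i l * (1%:M - K) l j))); last first.
    by move=> j _; rewrite mxE -[in RHS]mulrz_sumr.
  rewrite exchange_big; apply: eq_bigr => l _ /=.
  rewrite raddfMz fb -mulrzBl.
  transitivity ((\sum_j b j *~ (1%:M - K) l j) *~ (\adj (1%:M - K)) i l).
    by rewrite mulrz_suml; apply: eq_bigr => j _; rewrite -mulrzA mulrC.
  congr (intmul _ _).
  have -> : \sum_j b j *~ (1%:M - K) l j =
            \sum_j (b j *~ (1%:M : 'M_m) l j - b j *~ K l j).
    by apply: eq_bigr => j _; rewrite !mxE -mulrzBr.
  rewrite sumrB (bigD1 l) //= mxE eqxx mulr1n big1 ?addr0 // => j jl.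
  by rewrite mxE eq_sym (negPf jl) mulr0n mulr0z.
have [z zE] := choice Db.
exists (\sum_i z i *~ (a i %/ D)%Z); rewrite -fh.
rewrite [f _]raddf_sum -addrA -sumrB -big_split /=; apply: eq_bigr => i _.
rewrite raddfMz -mulrzBl -zE -mulrzA pmulrn gez0_abs ?modz_ge0 //.
by rewrite -mulrzDr addrC mulrC; congr (_ *~ _); exact: divz_eq.
Qed.

End FiniteCokernel.

(** * Tensor powers of a matrix *)

Section TensorPower.
Local Open Scope ring_scope.

(** The index is the degree minus one: [tpow A n] acts on tensors of degree
[n + 1], and [tdim r 0] is [r] by computation. *)
Fixpoint tdim r n : nat := if n is n'.+1 then (tdim r n' * r)%N else r.

Fixpoint tpow (R : pzRingType) r (A : 'M[R]_r) n : 'M[R]_(tdim r n) :=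
  if n is n'.+1 return 'M[R]_(tdim r n) then tpow A n' *t A else A.

Lemma map_tpow (R S : pzRingType) (f : {rmorphism R -> S}) r (A : 'M[R]_r) n :
  map_mx f (tpow A n) = tpow (map_mx f A) n.
Proof. by elim: n => //= n <-; rewrite map_mxT. Qed.

Lemma tpowM (R : comPzRingType) r (A B : 'M[R]_r) n :
  tpow (A *m B) n = tpow A n *m tpow B n.
Proof. by elim: n => //= n ->; rewrite tensmx_mul. Qed.

Lemma tens11 (R : comPzRingType) m n :
  (1%:M : 'M[R]_m) *t (1%:M : 'M[R]_n) = 1%:M.
Proof.
apply/matrixP => i j; case: (mxtens_indexP i) => i1 i2.
case: (mxtens_indexP j) => j1 j2; rewrite tensmxE !mxE.
by rewrite (inj_eq (can_inj (@mxtens_indexK _ _))) xpair_eqE -natrM mulnb.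
Qed.

Lemma tpow1 (R : comPzRingType) r n : tpow (1%:M : 'M[R]_r) n = 1%:M.
Proof. by elim: n => //= n ->; rewrite tens11. Qed.

Lemma tens_trig (R : pzRingType) m n (A : 'M[R]_m) (B : 'M[R]_n) :
  is_trig_mx A -> is_trig_mx B -> is_trig_mx (A *t B).
Proof.
move=> /is_trig_mxP tA /is_trig_mxP tB; apply/is_trig_mxP => k l.
case: (mxtens_indexP k) => i j; case: (mxtens_indexP l) => i' j' lt_kl.
rewrite tensmxE; case: (ltngtP i i') => [/tA ->|gt_i|eq_i].
- by rewrite mul0r.
- suff: (i' * n + j' < i * n + j)%N by rewrite ltnNge (ltnW lt_kl).
  apply: leq_trans (leq_addr _ _); apply: leq_trans (leq_mul gt_i (leqnn n)).
  by rewrite mulSn addnC ltn_add2r.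
- rewrite tB ?mulr0 //; move: lt_kl => /=.
  by rewrite eq_i ltn_add2l.
Qed.

Lemma tpow_trig (R : pzRingType) r (A : 'M[R]_r) n :
  is_trig_mx A -> is_trig_mx (tpow A n).
Proof. by move=> tA; elim: n => //= n IHn; exact: tens_trig. Qed.

Lemma tpow_diag (R : comPzRingType) r (A : 'M[R]_r) n (k : 'I_(tdim r n)) :
  exists2 I : seq 'I_r, size I = n.+1 & tpow A n k k = \prod_(i <- I) A i i.
Proof.
elim: n k => [|n IHn] k /=; first by exists [:: k]; rewrite ?big_seq1.
case: (mxtens_indexP k) => i j; have [I sI IE] := IHn i.
exists (j :: I); first by rewrite /= sI.
by rewrite big_cons tensmxE IE mulrC.
Qed.

(** The rows of [P] form a flag: the image of each one under [A] involves only the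
rows up to it. *)
Lemma trigonalize (C : numClosedFieldType) r (A : 'M[C]_r) : (0 < r)%N ->
  exists P T : 'M[C]_r, [/\ P \in unitmx, is_trig_mx T & P *m A = T *m P].
Proof.
move=> r0; have [P uP tP] := Schur A r0.
have {}uP := unitarymx_unit uP; exists P, (P *m A *m invmx P); split=> //.
  by rewrite -conjumx.
by rewrite mulmxKV.
Qed.

(** After trigonalization [tpow A n] becomes triangular, and its diagonal entries
are the products of [n + 1] eigenvalues of [A]. *)
Lemma det_sub1_tpow_neq0 (C : numClosedFieldType) r (A : 'M[C]_r) n : (0 < r)%N ->
  (forall I : seq C, size I = n.+1 -> all (root (char_poly A)) I ->
     \prod_(x <- I) x != 1) ->
  \det (1%:M - tpow A n) != 0.
Proof.
move=> r0 hA; have [P [T [uP tT PA]]] := trigonalize A r0.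
have rT i : root (char_poly A) (T i i).
  have <- : char_poly T = char_poly A.
    have -> : A = invmx P *m T *m P by rewrite -mulmxA -PA mulKmx.
    have mapI : map_mx polyC (invmx P) *m map_mx polyC P = 1%:M.
      by rewrite -map_mxM mulVmx // map_mx1.
    rewrite /char_poly /char_poly_mx; apply/esym.
    transitivity (\det (map_mx polyC (invmx P) *m ('X%:M - map_mx polyC T) *m map_mx polyC P)).
      congr (\det _); rewrite mulmxBr mulmxBl -!map_mxM; congr (_ - _).
      by rewrite scalar_mxC -mulmxA mapI mulmx1.
    by rewrite !det_mulmx mulrAC -det_mulmx mapI det1 mul1r.
  by rewrite char_poly_trig // /root horner_prod (bigD1 i) //= !hornerE subrr mul0r.
have tT' := tpow_trig n tT.
have detP : \det (tpow P n) != 0.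
  rewrite -unitfE -/(unitmx _); have [] // := @mulmx1_unit _ _ (tpow P n) (tpow (invmx P) n).
  by rewrite -tpowM mulmxV // tpow1.
have : \det (1%:M - tpow T n) != 0.
  rewrite det_trig; last first.
    apply/is_trig_mxP => i j ij; rewrite mxE [in X in _ + X]mxE (is_trig_mxP tT') // subr0.
    by rewrite mxE -val_eqE (ltn_eqF ij).
  apply/prodf_neq0 => k _; rewrite !mxE eqxx subr_eq0 eq_sym.
  have [I sI ->] := tpow_diag T k.
  rewrite -(big_map (fun i => T i i) xpredT id); apply: hA; rewrite ?size_map //.
  by apply/allP => _ /mapP[i _ ->].
apply: contraNN => /eqP det0; rewrite -(mulIr_eq0 _ (mulIf detP)) -det_mulmx.
rewrite mulmxBl mul1mx -tpowM -PA tpowM -[X in X - _]mulmx1 -mulmxBr det_mulmx.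
by rewrite det0 mulr0.
Qed.

End TensorPower.

(** * Companion matrices with generic eigenvalues *)

Section Companion.
Local Open Scope ring_scope.

Definition companion (R : pzRingType) s (a : 'I_s.+1 -> R) : 'M[R]_s.+1 :=
  \matrix_(i, j) if i == ord_max then a j else (j == i.+1 :> nat)%:R.

Lemma map_companion (R S : pzRingType) (f : {rmorphism R -> S}) s
    (a : 'I_s.+1 -> R) :
  map_mx f (companion a) = companion (f \o a).
Proof.
by apply/matrixP => i j; rewrite !mxE; case: eqP => // _; rewrite rmorph_nat.
Qed.

(** An eigenvector on columns must be proportional to the powers of the
eigenvalue; the last row then gives the characteristic equation. *)
Lemma root_companion (C : fieldType) s (a : 'I_s.+1 -> C) x :
  root (char_poly (companion a)) x -> \sum_j a j * x ^+ j = x ^+ s.+1.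
Proof.
rewrite -eigenvalue_root_char => ex.
have : \det (companion a - x%:M)^T == 0.
  rewrite det_tr; apply/det0P; have /eigenvalueP[v vx v0] := ex.
  by exists v => //; rewrite mulmxBr vx mul_mx_scalar subrr.
case/det0P => v v0 /(congr1 trmx); rewrite trmx_mul trmxK trmx0 mulmxBl => /eqP.
rewrite subr_eq0 mul_scalar_mx => /eqP vE.
have vS (i : nat) (lt_i : (i < s.+1)%N) : v 0 (Ordinal lt_i) = v 0 0 * x ^+ i.
  elim: i lt_i => [|i IHi] lt_i.
    by rewrite expr0 mulr1; congr (v 0 _); apply/val_inj.
  have /matrixP/(_ (Ordinal (ltnW lt_i)) 0) := vE.
  rewrite !mxE (bigD1 (Ordinal lt_i)) //= !mxE /= -val_eqE /= (ltn_eqF (lt_i : (i < s)%N)).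
  rewrite eqxx mul1r big1 => [|j ji].
    by rewrite addr0 IHi exprS mulrCA => ->.
  by rewrite !mxE -val_eqE /= (ltn_eqF (lt_i : (i < s)%N))
     -[j == _ :> nat]/(j == Ordinal lt_i) (negPf ji) mul0r.
have v00 : v 0 0 != 0.
  apply: contraNneq v0 => v00; apply/eqP/rowP => -[i lt_i].
  by rewrite vS v00 mul0r mxE.
have /matrixP/(_ ord_max 0) := vE; rewrite !mxE /= /ord_max vS => maxE.
apply: (mulfI v00); rewrite exprS mulrCA -maxE mulr_sumr; apply: eq_bigr => j _.
rewrite !mxE eqxx mulrCA; congr (_ * _).
by case: j => j lt_j; rewrite [RHS]vS.
Qed.

Fixpoint nth_prime n := if n is n'.+1 then s2val (prime_above (nth_prime n')) else 2.

Lemma nth_prime_prime n : prime (nth_prime n).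
Proof. by case: n => //= n; case: prime_above. Qed.

Lemma nth_prime_inj : injective nth_prime.
Proof.
have lt_S n : (nth_prime n < nth_prime n.+1)%N by rewrite /=; case: prime_above.
have lt_p : {homo nth_prime : m n / (m < n)%N}.
  by apply: homo_ltn lt_S => y x z; apply: ltn_trans.
move=> m n eq_mn; case: (ltngtP m n) => // /lt_p; by rewrite eq_mn ltnn.
Qed.

(** Distinct primes, completed so that the product of all roots is -1. *)
Definition generic_root s (i : 'I_s.+1) : rat :=
  if i == ord_max then - (\prod_(j < s) (nth_prime j)%:R)^-1
  else (nth_prime i)%:R.

Lemma prod_generic_root s : \prod_i @generic_root s i = -1.
Proof.
rewrite big_ord_recr /= /generic_root eqxx mulrN; congr (- _).
rewrite (eq_bigr (fun j : 'I_s => (nth_prime j)%:R)) => [|j _]; last first.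
  by rewrite -val_eqE /= ltn_eqF.
rewrite mulfV // prodf_seq_neq0; apply/allP => j _ /=.
by rewrite pnatr_eq0 -lt0n prime_gt0 // nth_prime_prime.
Qed.

(** Clearing denominators, a relation equates [P ^ m] with a product of primes up
to the sign [(-1) ^ m].  Unique factorization makes all roots occur equally
often, namely [m] times, and the sign makes [m] even; so a nonempty relation
has length at least twice the number of roots. *)
Lemma generic_root_free s (I : seq 'I_s.+1) :
  (0 < size I < 2 * s.+1)%N -> \prod_(i <- I) generic_root i != 1.
Proof.
move=> sI; apply/eqP => I1.
pose m := count_mem ord_max I; pose P := (\prod_(j < s) nth_prime j)%N.
pose d (j : 'I_s) := count_mem (widen_ord (leqnSn s) j) I.
have P0 : (P%:R : rat) != 0.
  by rewrite pnatr_eq0 -lt0n prodn_gt0 // => j; rewrite prime_gt0 // nth_prime_prime.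
have prodE : P%:R ^+ m * \prod_(i <- I) generic_root i =
    (-1) ^+ m * (\prod_(j < s) nth_prime j ^ d j)%N%:R.
  rewrite /m /d {m d sI I1}; elim: I => [|i I IHI] /=.
    by rewrite big_nil !mul1r big1 // => j _; rewrite /= expn0.
  rewrite big_cons exprD mulrACA IHI.
  have [->|i_max] /= := eqVneq i ord_max.
    rewrite expr1 /generic_root eqxx -natr_prod mulrN mulfV // exprS -[RHS]mulrA.
    congr (_ * (_ * _%:R)); apply: eq_bigr => j _; congr (_ ^ _)%N.
    by rewrite -val_eqE /= eqn_leq [(s <= j)%N]leqNgt ltn_ord.
  have lt_i : (i < s)%N.
    by have := ltn_ord i; rewrite ltnS leq_eqVlt -[i == s :> nat]/(i == ord_max) (negPf i_max).
  rewrite expr0 mul1r !add0n mulrCA; congr (_ * _).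
  rewrite /generic_root (negPf i_max) -natrM; congr (_%:R).
  rewrite [in RHS](bigD1 (Ordinal lt_i)) //= [in LHS](bigD1 (Ordinal lt_i)) //=.
  rewrite mulnA -expnS; congr (_ ^ _ * _)%N.
    by rewrite -val_eqE /= eqxx.
  apply: eq_bigr => j ji; congr (_ ^ _)%N.
  by rewrite -val_eqE /= eq_sym -[j == i :> nat]/(j == Ordinal lt_i) (negPf ji).
rewrite I1 mulr1 -natrX in prodE.
(* otherwise a negative number would equal a positive one *)
have even_m : ~~ odd m.
  apply/negP => odd_m; move: prodE; rewrite -signr_odd odd_m expr1 mulN1r => /eqP.
  have Q0 : (0 < \prod_(j < s) nth_prime j ^ d j)%N.
    by rewrite prodn_gt0 // => j; rewrite expn_gt0 prime_gt0 // nth_prime_prime.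
  rewrite -subr_eq0 opprK -natrD pnatr_eq0 addn_eq0 => /andP[_].
  by rewrite eqn0Ngt Q0.
move: prodE; rewrite -signr_odd (negPf even_m) expr0 mul1r => /eqP.
rewrite eqr_nat => /eqP PQ.
have logn_prod (f : 'I_s -> nat) (j : 'I_s) :
    logn (nth_prime j) (\prod_(i < s) nth_prime i ^ f i) = f j.
  rewrite (bigD1 j) //=; set Q := (\prod_(_ | _) _)%N.
  have Q0 : (0 < Q)%N.
    apply: prodn_cond_gt0 => i _.
    by rewrite expn_gt0 prime_gt0 // nth_prime_prime.
  rewrite lognM //; last by rewrite expn_gt0 prime_gt0 ?nth_prime_prime.
  rewrite pfactorK ?nth_prime_prime //.
  rewrite (_ : logn _ _ = 0%N) ?addn0 //.
  apply/logn_coprime/(big_ind (coprime _)) => [|u v cu cv|i ij]; first exact: coprimen1.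
    by rewrite coprimeMr cu.
  apply: coprimeXr; rewrite prime_coprime ?nth_prime_prime //.
  by rewrite dvdn_prime2 ?nth_prime_prime // (inj_eq nth_prime_inj) eq_sym.
have dm j : d j = m.
  by rewrite -(logn_prod d j) -PQ -[RHS](logn_prod (fun=> m) j)
     (big_morph (fun x => x ^ m)%N (fun x y => expnMn x y m) (exp1n m)).
have sizeE : size I = (m * s.+1)%N.
  rewrite -sum1_size (partition_big id predT) //= big_ord_recr /= sum1_count -/m.
  rewrite mulnSr; congr (_ + _)%N; rewrite (eq_bigr (fun=> m)) => [|j _].
    by rewrite sum_nat_const card_ord mulnC.
  by rewrite sum1_count -[RHS](dm j).
case/andP: sI; rewrite sizeE muln_gt0 ltn_pmul2r // => /andP[m0 _].
by move: even_m; case: (m) m0 => [|[|]].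
Qed.

(** The determinants are evaluated along the line of last rows [x * b], with
constant coefficient fixed.  As a function of [x] their product [E] is a
polynomial with [E.[1] != 0], by the choice of the generic roots.  Hence some
multiple [x] of the common denominator [d] of [b] is not a root of [E], and the
row at that [x] is integral. *)
Lemma exists_companion s c : (c < 2 * s.+1)%N ->
  exists (e : bool) (a : 'I_s.+1 -> int), a 0 = (-1) ^+ e /\
    forall n, (n < c)%N -> \det (1%:M - tpow (companion a) n) != 0.
Proof.
move=> lt_c.
pose f := \prod_(i < s.+1) ('X - (generic_root i)%:P).
have f_monic : f \is monic by apply: monic_prod_XsubC.
have size_f : size f = s.+2 by rewrite /f -(big_enum _ _ predT) size_prod_XsubC size_enum_ord.
have f0 : - f`_0 = (-1) ^+ s.+1.
  rewrite -horner_coef0 horner_prod (eq_bigr (fun i => - generic_root i)) => [|i _].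
    by rewrite prodrN prod_generic_root card_ord mulrN1 opprK.
  by rewrite !hornerE.
pose line (S : comNzRingType) (x : S) (b : 'I_s.+1 -> S) (j : 'I_s.+1) :=
  if j == 0 then (-1) ^+ s.+1 else x * b j.
pose A := companion (line _ 'X (fun j => (- f`_j)%:P)).
pose E := \prod_(n < c) \det (1%:M - tpow A n).
have hornerA x n : (\det (1%:M - tpow A n)).[x] =
    \det (1%:M - tpow (companion (line _ x (fun j => - f`_j))) n).
  rewrite -[LHS]/(horner_eval x _) -det_map_mx map_mxB map_mx1 map_tpow map_companion.
  congr (\det (_ - tpow (companion _) _)); apply/funext => j; rewrite /= /line.
  by case: eqP => _; rewrite /= /horner_eval ?hornerE // rmorphXn /= rmorphN1.
have E1 : E.[1] != 0.
  rewrite horner_prod; apply/prodf_neq0 => n _; rewrite hornerA.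
  rewrite -(fmorph_eq0 (ratr : {rmorphism rat -> algC})) -det_map_mx map_mxB map_mx1.
  rewrite map_tpow map_companion; apply: det_sub1_tpow_neq0 => // I sI rI.
  have /choice[i iE] : forall x, exists i, x \in I -> x = ratr (@generic_root s i).
    move=> x; have [xI|] := boolP (x \in I); last by exists 0.
    have /root_companion sumE := allP rI _ xI.
    have : (map_poly (ratr : {rmorphism rat -> algC}) f).[x] = 0.
      rewrite horner_coef size_map_poly size_f big_ord_recr /= coef_map.
      have /monicP := f_monic; rewrite lead_coefE size_f /= => ->.
      rewrite rmorph1 mul1r -sumE -big_split big1 //= => j _.
      rewrite coef_map /line mul1r; case: eqP => [->|_] /=.
        by rewrite -f0 rmorphN mulNr addrN.
      by rewrite rmorphN mulNr addrN.
    rewrite /f rmorph_prod horner_prod => /eqP/prodf_eq0[i _].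
    rewrite rmorphB /= map_polyX map_polyC hornerXsubC subr_eq0 => /eqP xE.
    by exists i.
  pose I' := [seq i x | x <- I].
  have -> : \prod_(x <- I) x = ratr (\prod_(j <- I') generic_root j).
    by rewrite rmorph_prod big_map !big_seq; apply: eq_bigr => x /iE.
  rewrite (fmorph_eq1 (ratr : {rmorphism rat -> algC})).
  by apply: generic_root_free; rewrite size_map sI /= (leq_ltn_trans _ lt_c).
pose d := (\prod_(j < s.+1) `|denq f`_j|)%N.
have d0 : (0 < d)%N by rewrite prodn_gt0 // => j; rewrite absz_gt0 denq_neq0.
have dE (j : 'I_s.+1) : exists z : int, d%:R * (- f`_j) = z%:~R.
  exists (- (\prod_(i < s.+1 | i != j) `|denq f`_i|)%N%:Z * numq f`_j).
  rewrite /d (bigD1 j) //= natrM [_ * _%:R in LHS]mulrC mulrN -mulrA.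
  have -> : `|denq f`_j|%:R * f`_j = (numq f`_j)%:~R.
    rewrite -{2}[f`_j]divq_num_den mulrC pmulrn gez0_abs ?denq_ge0 //.
    by rewrite divfK // intr_eq0 denq_neq0.
  by rewrite intrM rmorphN mulNr.
have [t Et] : exists t : nat, E.[(t * d)%:R] != 0.
  have E0 : E != 0 by apply: contraNneq E1 => ->; rewrite horner0.
  apply: contrapT => noroot.
  pose rs : seq rat := [seq (t * d)%:R | t <- iota 0 (size E)].
  have : (size rs < size E)%N.
    apply: max_poly_roots => //.
      apply/allP => _ /mapP[t _ ->]; apply: contrapT => /negP Et.
      by apply: noroot; exists t.
    rewrite map_inj_uniq ?iota_uniq // => t t' /eqP.
    by rewrite eqr_nat eqn_pmul2r // => /eqP.
  by rewrite size_map size_iota ltnn.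
have [b bE] := choice dE.
exists (odd s.+1), (line _ t%:R (fun j : 'I_s.+1 => b j)); split.
  by rewrite /line eqxx signr_odd.
move=> n lt_n; rewrite -(intr_eq0 rat) -det_map_mx map_mxB map_mx1 map_tpow map_companion.
move: Et; rewrite horner_prod => /prodf_neq0/(_ (Ordinal lt_n) isT).
rewrite hornerA; apply: contraNneq => det0; apply/eqP; rewrite -[RHS]det0.
congr (\det (_ - tpow (companion _) _)); apply/funext => j; rewrite /= /line.
case: eqP => _; first by rewrite rmorphXn /= rmorphN1.
by rewrite natrM -mulrA bE intrM -[RHS]/(_%:~R * _) rmorph_nat.
Qed.

End Companion.

(** * Free groups and their abelianization *)

Section GroupMorphism.
Variables (G H : groupType) (f : G -> H).
Local Open Scope group_scope.
Hypothesis fM : {morph f : x y / x * y}.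

Lemma gmorph1 : f 1 = 1.
Proof. by apply: (@mulgI _ (f 1)); rewrite -fM !mulg1. Qed.

Lemma gmorphV x : f x^-1 = (f x)^-1.
Proof. by apply/esym/mulg1_eq; rewrite -fM mulgV gmorph1. Qed.

Lemma gmorphX x n : f (x ^+ n) = f x ^+ n.
Proof. by elim: n => [|n IHn]; rewrite ?gmorph1 // !expgS fM IHn. Qed.

End GroupMorphism.

Section FreeGroupTheory.
Variable T : choiceType.
Local Open Scope group_scope.
Notation F := (free_group T).

(** An action of letters in which inverse letters act inversely is an action of
the free group; every map defined below by recursion on reduced words is
multiplicative for this reason. *)
Section LetterAction.
Variables (X : Type) (act : T * bool -> X -> X).
Hypothesis actK : forall a x, act a (act (letterV a) x) = x.

Lemma foldr_push a w x : foldr act x (push a w) = act a (foldr act x w).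
Proof. by case: w => //= b w; case: eqVneq => // ->; rewrite actK. Qed.

Lemma foldr_word_mul u v x :
  foldr act x (word_mul u v) = foldr act (foldr act x v) u.
Proof. by elim: u => //= a u IHu; rewrite foldr_push IHu. Qed.

End LetterAction.

Definition gen (i : T) : F := @FreeGroup T [:: (i, true)] isT.

Definition letter_val (H : groupType) (h : T -> H) (a : T * bool) : H :=
  if a.2 then h a.1 else (h a.1)^-1.

Definition free_lift (H : groupType) (h : T -> H) (x : F) : H :=
  foldr (fun a y => letter_val h a * y) 1 (fword x).

Lemma letter_valV (H : groupType) (h : T -> H) a :
  letter_val h (letterV a) = (letter_val h a)^-1.
Proof. by case: a => i [] //=; rewrite /letter_val /= invgK. Qed.

Fact free_lift_morph (H : groupType) (h : T -> H) :
  {morph free_lift h : x y / x * y}.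
Proof.
move=> x y; rewrite /free_lift /= foldr_word_mul => [|a z]; last first.
  by rewrite letter_valV mulVKg.
by elim: (fword x) => [|a w IHw] /=; rewrite ?mul1g // IHw mulgAg.
Qed.
HB.instance Definition _ (H : groupType) (h : T -> H) :=
  isMultiplicative.Build F H (free_lift h) (@free_lift_morph H h).

Lemma free_lift_gen (H : groupType) (h : T -> H) i : free_lift h (gen i) = h i.
Proof. exact: mulg1. Qed.

Lemma free_group_ind (P : F -> Prop) : P 1 ->
  (forall i x, P x -> P (gen i * x)) -> (forall i x, P x -> P ((gen i)^-1 * x)) ->
  forall x, P x.
Proof.
move=> P1 PM PV [w rw]; elim: w rw => [|a w IHw] rw.
  by have -> : FreeGroup rw = 1 by exact/val_inj.
have rw' := reduced_behead rw; have {}IHw := IHw rw'.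
have pushE : push a w = a :: w.
  by case: (w) rw => //= b w' /andP[/negPf ->].
case: a rw pushE => i [] rw pushE.
  have -> : FreeGroup rw = gen i * FreeGroup rw' by exact/val_inj/esym.
  exact: PM.
have -> : FreeGroup rw = (gen i)^-1 * FreeGroup rw' by exact/val_inj/esym.
exact: PV.
Qed.

Lemma eq_free_morph (H : groupType) (f g : F -> H) :
  {morph f : x y / x * y} -> {morph g : x y / x * y} ->
  (forall i, f (gen i) = g (gen i)) -> f =1 g.
Proof.
move=> fM gM fg.
elim/free_group_ind => [|i x IHx|i x IHx]; first by rewrite !gmorph1.
  by rewrite fM gM fg IHx.
by rewrite fM gM !gmorphV // fg IHx.
Qed.

End FreeGroupTheory.

Section Abelianization.
Variable r : nat.
Notation F := (free_group 'I_r).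
Local Open Scope ring_scope.

Definition abel_letter (a : 'I_r * bool) (v : 'rV[int]_r) : 'rV[int]_r :=
  if a.2 then v + delta_mx 0 a.1 else v - delta_mx 0 a.1.

Definition abel (x : F) : 'rV[int]_r := foldr abel_letter 0 (fword x).

Lemma abelM x y : abel (x * y)%g = abel x + abel y.
Proof.
rewrite /abel /= foldr_word_mul => [|[i []] v]; rewrite /abel_letter /= ?addrK ?subrK //.
elim: (fword x) => [|a w IHw] /=; first by rewrite add0r.
by rewrite IHw /abel_letter; case: a.2; rewrite addrAC.
Qed.

Lemma abel1 : abel 1%g = 0. Proof. by []. Qed.

Lemma abelV x : abel x^-1%g = - abel x.
Proof. by apply/eqP; rewrite -addr_eq0 -abelM mulVg. Qed.

Lemma abel_gen i : abel (gen i) = delta_mx 0 i.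
Proof. by rewrite /abel /= /abel_letter add0r. Qed.

(** A homomorphism to an abelian group factors through [abel]. *)
Lemma free_additiveE (Y : zmodType) (f : F -> Y) :
  (forall x y, f (x * y)%g = f x + f y) ->
  forall x, f x = \sum_i f (gen i) *~ abel x 0 i.
Proof.
move=> fM.
have f1 : f 1%g = 0 by apply: (addrI (f 1%g)); rewrite -fM mulg1 addr0.
have fV x : f x^-1%g = - f x by apply/eqP; rewrite -addr_eq0 -fM mulVg f1.
have sumE i : \sum_j f (gen j) *~ abel (gen i) 0 j = f (gen i).
  rewrite (bigD1 i) //= abel_gen mxE !eqxx mulr1z big1 ?addr0 // => j ji.
  by rewrite mxE (negPf ji) andbF mulr0z.
elim/free_group_ind => [|i x IHx|i x IHx].
- by rewrite f1 big1 // => i _; rewrite mxE mulr0z.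
- rewrite fM IHx -{1}sumE -big_split; apply: eq_bigr => j _ /=.
  by rewrite abelM [in RHS]mxE mulrzDr.
- rewrite fM fV IHx -{1}sumE -sumrN -big_split; apply: eq_bigr => j _ /=.
  by rewrite abelM abelV [in RHS]mxE [X in _ *~ (X + _)]mxE mulrzDr mulrNz.
Qed.

Definition abel_mx (f : F -> F) : 'M[int]_r := \matrix_i abel (f (gen i)).

Lemma abel_morph (f : F -> F) : {morph f : x y / (x * y)%g} ->
  forall x, abel (f x) = abel x *m abel_mx f.
Proof.
move=> fM x; have fM' y z : (abel \o f) (y * z)%g = (abel \o f) y + (abel \o f) z.
  by rewrite /= fM abelM.
rewrite -[LHS]/((abel \o f) x) (free_additiveE fM') mulmx_sum_row.
by apply: eq_bigr => i _; rewrite rowK -scaler_int intz.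
Qed.

Lemma abel_mx_comp (f g : F -> F) : {morph f : x y / (x * y)%g} ->
  abel_mx (f \o g) = abel_mx g *m abel_mx f.
Proof.
by move=> fM; apply/row_matrixP => i; rewrite row_mul !rowK /= abel_morph.
Qed.

End Abelianization.

(** * Sums of polynomials along the walk of a word *)

Section PolyShift.
Variable C : numFieldType.
Local Open Scope ring_scope.

Definition pshift (c : C) (p : {poly C}) := p \Po ('X + c%:P).

Lemma pshiftD c p q : pshift c (p + q) = pshift c p + pshift c q.
Proof. exact: comp_polyD. Qed.
Lemma pshiftB c p q : pshift c (p - q) = pshift c p - pshift c q.
Proof. exact: comp_polyB. Qed.
Lemma pshift0p c : pshift c 0 = 0.
Proof. exact: comp_poly0. Qed.
Lemma pshift0 p : pshift 0 p = p.
Proof. by rewrite /pshift addr0 comp_polyXr. Qed.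
Lemma pshift_comp c d p : pshift c (pshift d p) = pshift (c + d) p.
Proof.
by rewrite /pshift -comp_polyA comp_polyD comp_polyX comp_polyC polyCD addrA.
Qed.
Lemma horner_pshift c p x : (pshift c p).[x] = p.[x + c].
Proof. by rewrite horner_comp !hornerE. Qed.
Lemma pshiftC c a : pshift c a%:P = a%:P.
Proof. exact: comp_polyC. Qed.

Lemma size_pshift c (p : {poly C}) : size (pshift c p) = size p.
Proof. by rewrite size_comp_poly2 // size_XaddC. Qed.

Lemma size_pshift_sub c (p : {poly C}) n :
  (size p <= n.+1)%N -> (size (pshift c p - p)%R <= n)%N.
Proof.
move=> sp; apply/leq_sizeP => k; rewrite leq_eqVlt => /predU1P[<-|lt_nk].
  move: sp; rewrite coefB leq_eqVlt => /predU1P[sp|lt_p]; last first.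
    by rewrite !nth_default ?size_pshift ?subrr.
  have := lead_coef_comp p (_ : (1 < size ('X + c%:P)%R)%N).
  rewrite size_XaddC => /(_ isT); rewrite lead_coefXaddC expr1n mulr1.
  by rewrite !lead_coefE -/(pshift c p) size_pshift sp /= => ->; rewrite subrr.
by rewrite coefB !nth_default ?size_pshift ?subrr // (leq_trans sp).
Qed.

Lemma pshift_Xn c n :
  exists2 p : {poly C}, (size p <= n)%N &
    pshift c 'X^(n.+1) = 'X^(n.+1) + (n.+1%:R * c) *: 'X^n + p.
Proof.
rewrite /pshift comp_Xn_poly; elim: n => [|n [p sp IHn]].
  by exists 0; rewrite ?size_poly0 // expr1 mul1r addr0 expr0 alg_polyC.
exists ((n.+1%:R * c * c) *: 'X^n + ('X + c%:P) * p).
  apply: (leq_trans (size_polyD _ _)); rewrite geq_max; apply/andP; split.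
    by apply: (leq_trans (size_scale_leq _ _)); rewrite size_polyXn.
  by apply: (leq_trans (size_polyMleq _ _)); rewrite size_XaddC.
rewrite exprS IHn -!mul_polyC !polyCM !polyC_natr.
rewrite -natr1 !exprS; ring.
Qed.

End PolyShift.

(** The word [x] is a walk on a line: the letter [x_i] is a step of length [xi i].
Each step contributes the value of [q i] at its starting point, or minus the
value at its end point for an inverse letter.  As a function of the point where
the walk starts, the total is the polynomial [path_poly xi q x].  These are the
Fox derivatives of [x], with [x_i] specialized to [exp (xi i)]: the monomial
['X^n] picks out [n!] times the homogeneous part of degree [n]. *)
Section PolynomialPathSum.
Variables (C : numFieldType) (r : nat).
Notation F := (free_group 'I_r).
Local Open Scope ring_scope.
Implicit Types (xi eta : 'I_r -> C) (q : 'I_r -> {poly C}) (x y : F).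

Definition height xi x : C := \sum_i xi i * (abel x 0 i)%:~R.

Lemma heightM xi x y : height xi (x * y)%g = height xi x + height xi y.
Proof.
rewrite -big_split; apply: eq_bigr => i _ /=.
by rewrite abelM [in LHS]mxE intrD mulrDr.
Qed.
Lemma height1 xi : height xi 1%g = 0.
Proof. by rewrite /height abel1 big1 // => i _; rewrite mxE mulr0. Qed.
Lemma heightV xi x : height xi x^-1%g = - height xi x.
Proof. by apply/eqP; rewrite -addr_eq0 -heightM mulVg height1. Qed.
Lemma height_gen xi i : height xi (gen i) = xi i.
Proof.
rewrite /height abel_gen (bigD1 i) //= mxE !eqxx mulr1 big1 ?addr0 // => j ji.
by rewrite mxE (negPf ji) andbF mulr0.
Qed.

Definition path_letter xi q (a : 'I_r * bool) (p : {poly C}) : {poly C} :=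
  if a.2 then q a.1 + pshift (xi a.1) p else pshift (- xi a.1) (p - q a.1).

Definition path_poly xi q x : {poly C} := foldr (path_letter xi q) 0 (fword x).

Lemma path_letterK xi q a p :
  path_letter xi q a (path_letter xi q (letterV a) p) = p.
Proof.
case: a => i []; rewrite /path_letter /=.
  by rewrite pshift_comp subrr pshift0 addrC subrK.
by rewrite addrAC subrr add0r pshift_comp addNr pshift0.
Qed.

Lemma path_poly_genM xi q i x :
  path_poly xi q (gen i * x)%g = q i + pshift (xi i) (path_poly xi q x).
Proof. by rewrite /path_poly /= foldr_push => [|a p]; rewrite ?path_letterK. Qed.

Lemma path_poly_genVM xi q i x : path_poly xi q ((gen i)^-1 * x)%g =
  pshift (- xi i) (path_poly xi q x - q i).
Proof. by rewrite /path_poly /= foldr_push => [|a p]; rewrite ?path_letterK. Qed.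

Lemma path_poly1 xi q : path_poly xi q 1%g = 0. Proof. by []. Qed.

Lemma path_polyM xi q x y :
  path_poly xi q (x * y)%g = path_poly xi q x + pshift (height xi x) (path_poly xi q y).
Proof.
elim/free_group_ind: x => [|i x IHx|i x IHx].
- by rewrite mul1g height1 pshift0 path_poly1 add0r.
- rewrite -mulgA !path_poly_genM IHx pshiftD addrA pshift_comp.
  by rewrite heightM height_gen.
- rewrite -mulgA !path_poly_genVM IHx heightM heightV height_gen.
  by rewrite -pshift_comp -pshiftD addrAC.
Qed.

Lemma path_polyV xi q x :
  path_poly xi q x^-1%g = - pshift (- height xi x) (path_poly xi q x).
Proof.
apply/eqP; rewrite -addr_eq0 -heightV -path_polyM mulVg; exact/eqP.
Qed.

Lemma path_polyB xi q q' x :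
  path_poly xi (fun i => q i - q' i) x = path_poly xi q x - path_poly xi q' x.
Proof.
elim/free_group_ind: x => [|i x IHx|i x IHx].
- by rewrite !path_poly1 subrr.
- rewrite !path_poly_genM IHx pshiftB opprD !addrA; congr (_ + _).
  by rewrite -!addrA; congr (_ + _); rewrite addrC.
- rewrite !path_poly_genVM IHx -pshiftB; congr pshift.
  by ring.
Qed.

Lemma path_polyZ xi (k : C) q x :
  path_poly xi (fun i => k *: q i) x = k *: path_poly xi q x.
Proof.
have shZ c p : pshift c (k *: p) = k *: pshift c p by exact: comp_polyZ.
elim/free_group_ind: x => [|i x IHx|i x IHx].
- by rewrite !path_poly1 scaler0.
- by rewrite !path_poly_genM IHx shZ scalerDr.
- by rewrite !path_poly_genVM IHx -scalerBr shZ.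
Qed.

Lemma path_poly_pshift xi q c x :
  path_poly xi (fun i => pshift c (q i)) x = pshift c (path_poly xi q x).
Proof.
elim/free_group_ind: x => [|i x IHx|i x IHx].
- by rewrite !path_poly1 pshift0p.
- by rewrite !path_poly_genM IHx pshiftD !pshift_comp [c + _]addrC.
- by rewrite !path_poly_genVM IHx -pshiftB !pshift_comp [c + _]addrC.
Qed.

Lemma size_path_poly xi q n x :
  (forall i, (size (q i) <= n)%N) -> (size (path_poly xi q x) <= n)%N.
Proof.
move=> sq; elim/free_group_ind: x => [|i x IHx|i x IHx].
- by rewrite path_poly1 size_poly0.
- rewrite path_poly_genM (leq_trans (size_polyD _ _)) // geq_max sq.
  by rewrite size_pshift.
- rewrite path_poly_genVM size_pshift (leq_trans (size_polyD _ _)) // geq_max.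
  by rewrite size_polyN IHx sq.
Qed.

Lemma path_polyC xi eta x :
  path_poly xi (fun i => (eta i)%:P) x = (height eta x)%:P.
Proof.
elim/free_group_ind: x => [|i x IHx|i x IHx].
- by rewrite path_poly1 height1.
- by rewrite path_poly_genM IHx heightM height_gen pshiftC polyCD.
- by rewrite path_poly_genVM IHx -polyCB pshiftC heightM heightV height_gen addrC.
Qed.

(** In top degree the starting points of the steps do not matter, only the
abelianization does. *)
Lemma coef_path_poly xi q n x : (forall i, (size (q i) <= n.+1)%N) ->
  (path_poly xi q x)`_n = height (fun i => (q i)`_n) x.
Proof.
move=> sq.
have coef_sh c (p : {poly C}) : (size p <= n.+1)%N -> (pshift c p)`_n = p`_n.
  by move=> /(size_pshift_sub c)/leq_sizeP/(_ _ (leqnn n)); rewrite coefB => /eqP;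
    rewrite subr_eq0 => /eqP.
elim/free_group_ind: x => [|i x IHx|i x IHx].
- by rewrite path_poly1 coef0 height1.
- by rewrite path_poly_genM coefD coef_sh ?size_path_poly // IHx heightM height_gen.
- rewrite path_poly_genVM coef_sh; last first.
    by rewrite (leq_trans (size_polyD _ _)) // geq_max size_polyN size_path_poly // sq.
  by rewrite coefB IHx heightM heightV height_gen addrC.
Qed.

(** Chain rule: the walk of [f x] runs through the walks of the [f (gen i)], which
are displaced by the walk of [x] whose step lengths are their total lengths. *)
Lemma path_poly_morph xi q (f : F -> F) : {morph f : x y / (x * y)%g} ->
  forall x, path_poly xi q (f x) =
    path_poly (fun i => height xi (f (gen i))) (fun i => path_poly xi q (f (gen i))) x.
Proof.
move=> fM; have f1 := gmorph1 fM.
have fV := gmorphV fM.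
elim/free_group_ind => [|i x IHx|i x IHx].
- by rewrite f1 !path_poly1.
- by rewrite fM path_polyM path_poly_genM IHx.
- by rewrite fM fV path_polyM path_polyV heightV path_poly_genVM IHx pshiftB addrC.
Qed.

End PolynomialPathSum.

(** * The depth filtration and its leading terms *)

Section Depth.
Variables (C : numFieldType) (r : nat).
Notation F := (free_group 'I_r).
Local Open Scope classical_set_scope.
Local Open Scope ring_scope.
Implicit Types (xi eta : 'I_r -> C) (q : 'I_r -> {poly C}) (x y : F).

Definition path_sum xi q x : C := (path_poly xi q x).[0].

Lemma path_sumM xi q x y : path_sum xi q (x * y)%g =
  path_sum xi q x + path_sum xi (fun i => pshift (height xi x) (q i)) y.
Proof. by rewrite /path_sum path_polyM hornerD path_poly_pshift. Qed.

Lemma path_sumV xi q x : path_sum xi q x^-1%g =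
  - path_sum xi (fun i => pshift (- height xi x) (q i)) x.
Proof. by rewrite /path_sum path_polyV hornerN path_poly_pshift. Qed.

Lemma path_sumB xi q q' x :
  path_sum xi (fun i => q i - q' i) x = path_sum xi q x - path_sum xi q' x.
Proof. by rewrite /path_sum path_polyB hornerD hornerN. Qed.

Lemma path_sum1 xi q : path_sum xi q 1%g = 0.
Proof. by rewrite /path_sum path_poly1 horner0. Qed.

Definition deep n : set F :=
  [set x | forall xi q, (forall i, (size (q i) <= n)%N) -> path_sum xi q x = 0].

Lemma deep0 x : deep 0 x.
Proof.
move=> xi q sq; rewrite /path_sum.
have : (size (path_poly xi q x) <= 0)%N by apply: size_path_poly.
by rewrite leqn0 size_poly_eq0 => /eqP ->; rewrite horner0.
Qed.

Lemma deep_le m n x : (m <= n)%N -> deep n x -> deep m x.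
Proof. by move=> lemn dx xi q sq; apply: dx => i; apply: leq_trans lemn. Qed.

Lemma deep_height n x xi : deep n.+1 x -> height xi x = 0.
Proof.
move=> dx; have := dx xi (fun i => (xi i)%:P); rewrite /path_sum path_polyC hornerC.
by apply=> i; rewrite (leq_trans (size_polyC_leq1 _)).
Qed.

(** Shifting a polynomial changes it only by one of smaller degree.  This is why
sums of degree [n] are additive on [deep n]. *)
Lemma deep_pshift n x xi q c : deep n x -> (forall i, (size (q i) <= n.+1)%N) ->
  path_sum xi (fun i => pshift c (q i)) x = path_sum xi q x.
Proof.
move=> dx sq; apply/eqP; rewrite -subr_eq0 -path_sumB; apply/eqP/dx => i.
exact: size_pshift_sub.
Qed.

Lemma deep_sumM n x y xi q : deep n y -> (forall i, (size (q i) <= n.+1)%N) ->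
  path_sum xi q (x * y)%g = path_sum xi q x + path_sum xi q y.
Proof. by move=> dy sq; rewrite path_sumM (deep_pshift _ _ dy). Qed.

Lemma deep_sumV n x xi q : deep n x -> (forall i, (size (q i) <= n.+1)%N) ->
  path_sum xi q x^-1%g = - path_sum xi q x.
Proof. by move=> dx sq; rewrite path_sumV (deep_pshift _ _ dx). Qed.

Lemma deep_subgroup n : is_subgroup (deep n).
Proof.
split=> [xi q _|x y dx dy xi q sq]; first exact: path_sum1.
have sq' i : (size (q i) <= n.+1)%N by apply: leqW.
have dy' : deep n y^-1%g.
  move=> xi' q' sq2; rewrite (deep_sumV _ dy) ?dy ?oppr0 // => i; exact: leqW.
by rewrite (deep_sumM _ _ dy') // dx // dy' // addr0.
Qed.

(** For a closed walk [x], the commutator with [y] compares the walk of [x] with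
its translate by [y]. *)
Lemma path_sum_comm xi q x y : height xi x = 0 -> path_sum xi q [~ x, y]%g =
  path_sum xi (fun i => pshift (- height xi y) (q i)) x - path_sum xi q x.
Proof.
move=> hx; rewrite /path_sum !path_poly_pshift /commg /conjg !path_polyM !path_polyV.
rewrite !heightV hx oppr0 !pshift0 !pshiftD !(hornerD, hornerN).
ring.
Qed.

Lemma deep_comm n x y : deep n x -> deep n.+1 [~ x, y]%g.
Proof.
case: n => [|n] dx xi q sq.
  have qC : q = fun i => ((q i)`_0)%:P by apply/funext => i; exact/size1_polyC.
  rewrite /path_sum qC path_polyC hornerC /commg /conjg !heightM !heightV; ring.
by rewrite path_sum_comm ?(deep_height _ dx) // (deep_pshift _ _ dx) ?subrr.
Qed.

(** Closed walks contribute independently of their position, so their commutators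
are invisible: this is where the second derived group disappears. *)
Lemma deep_comm_deep n x y : deep 1 x -> deep 1 y -> deep n [~ x, y]%g.
Proof.
move=> dx dy xi q _; rewrite path_sum_comm ?(deep_height _ dx) //.
rewrite (deep_height _ dy) oppr0 -path_sumB.
under eq_fun do rewrite pshift0 subrr.
rewrite /path_sum (_ : (fun=> 0) = fun i : 'I_r => (0 : C)%:P) ?polyC0 //.
rewrite path_polyC hornerC /height big1 // => i _; exact: mul0r.
Qed.

Lemma lower_central_deep n : (lower_central n.+1 : set F) `<=` deep n.
Proof.
rewrite /lower_central /=; elim: n => [|n IHn] x; first by move=> _; apply: deep0.
apply: smallest_sub; first exact: deep_subgroup.
by move=> _ [u Hu [v _ <-]]; apply: deep_comm; apply: IHn.
Qed.

Lemma derived2_deep n : (derived 2 : set F) `<=` deep n.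
Proof.
apply: smallest_sub; first exact: deep_subgroup.
have d1 : (derived 1 : set F) `<=` deep 1.
  apply: smallest_sub; first exact: deep_subgroup.
  by move=> _ [u _ [v _ <-]]; apply: deep_comm; apply: deep0.
by move=> _ [u Hu [v Hv <-]]; apply: deep_comm_deep; apply: d1.
Qed.

(** A point of the domain of [V] is a pair of linear forms: step lengths [xi], and
the coefficients [eta] of the monomials that are summed. *)
Notation V := (('I_r -> C) * ('I_r -> C) -> C^o).

Definition leading n x : V := fun z => path_sum z.1 (fun i => z.2 i *: 'X^n) x.

Let size_monom n (c : C) : (size (c *: 'X^n)%R <= n.+1)%N.
Proof. by rewrite (leq_trans (size_scale_leq _ _)) // size_polyXn. Qed.

Lemma leadingM n x y : deep n y -> leading n (x * y)%g = leading n x + leading n y.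
Proof. by move=> dy; apply/funext => z; rewrite /leading (deep_sumM _ _ dy). Qed.

Lemma leadingV n x : deep n x -> leading n x^-1%g = - leading n x.
Proof. by move=> dx; apply/funext => z; rewrite /leading (deep_sumV _ dx). Qed.

Lemma leadingX n x k : deep n x -> leading n (x ^+ k)%g = k%:R *: leading n x.
Proof.
move=> dx; elim: k => [|k IHk].
  by rewrite scale0r; apply/funext => z; rewrite /leading path_sum1.
by rewrite expgSr leadingM // IHk -natr1 scalerDl scale1r.
Qed.

Lemma deepX n x k : deep n x -> deep n (x ^+ k)%g.
Proof.
move=> dx; elim: k => [|k IHk]; first exact: (deep_subgroup n).1.
rewrite expgSr; apply: (subgroupM (deep_subgroup n)) IHk dx.
Qed.

Lemma leading_deep n x : deep n.+1 x -> leading n x = 0.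
Proof. by move=> dx; apply/funext => z; rewrite /leading dx. Qed.

Let size_sub_top n (p : {poly C}) :
  (size p <= n.+1)%N -> (size (p - p`_n *: 'X^n)%R <= n)%N.
Proof.
move=> sp; apply/leq_sizeP => k; rewrite leq_eqVlt => /predU1P[<-|lt_nk].
  by rewrite coefB coefZ coefXn eqxx mulr1 subrr.
by rewrite coefB coefZ coefXn gtn_eqF // mulr0 subr0 nth_default // (leq_trans sp).
Qed.

Lemma path_sum_top n x xi q : deep n x -> (forall i, (size (q i) <= n.+1)%N) ->
  path_sum xi q x = leading n x (xi, fun i => (q i)`_n).
Proof.
move=> dx sq; apply/eqP; rewrite -subr_eq0 /leading -path_sumB; apply/eqP/dx => i.
exact: size_sub_top.
Qed.

Lemma deepS n x : deep n x -> leading n x = 0 -> deep n.+1 x.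
Proof. by move=> dx lx xi q sq; rewrite (path_sum_top _ dx) // lx. Qed.

Section Endomorphism.
Variables (f : F -> F) (fM : {morph f : x y / (x * y)%g}).

Definition pull (z : ('I_r -> C) * ('I_r -> C)) : ('I_r -> C) * ('I_r -> C) :=
  (fun i => height z.1 (f (gen i)), fun i => height z.2 (f (gen i))).

Lemma path_sum_morph xi q x : path_sum xi q (f x) =
  path_sum (fun i => height xi (f (gen i))) (fun i => path_poly xi q (f (gen i))) x.
Proof. by rewrite /path_sum path_poly_morph. Qed.

Lemma deep_morph n x : deep n x -> deep n (f x).
Proof.
by move=> dx xi q sq; rewrite path_sum_morph dx // => i; exact: size_path_poly.
Qed.

(** By the chain rule the summed polynomials become the [path_poly] of the
[f (gen i)], of which only the top coefficients count on [deep n]. *)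
Lemma leading_morph n x : deep n x -> leading n (f x) = leading n x \o pull.
Proof.
move=> dx; apply/funext => z; rewrite /leading path_sum_morph (path_sum_top _ dx).
  congr (leading n x (_, _)); apply/funext => i.
  rewrite coef_path_poly //; congr (height _ _); apply/funext => j.
  by rewrite coefZ coefXn eqxx mulr1.
by move=> i; apply: size_path_poly.
Qed.

End Endomorphism.

(** The commutator with [y] acts as the derivative along [y]: in degree [n + 2] the
translate of the monomial differs from it by [n + 2] times the translation times
the monomial of degree [n + 1]. *)
Lemma leading_comm n x y z : deep n.+1 x ->
  leading n.+2 [~ x, y]%g z = - (n.+2%:R * height z.1 y) * leading n.+1 x z.
Proof.
move=> dx; rewrite {1}/leading path_sum_comm ?(deep_height _ dx) // -path_sumB.
rewrite (path_sum_top _ dx) => [|i]; last first.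
  by apply: size_pshift_sub; rewrite (leq_trans (size_scale_leq _ _)) ?size_polyXn.
set c := height _ y; set u := (X in leading _ _ (_, X)).
have -> : u = fun i => - (n.+2%:R * c) * z.2 i.
  apply/funext => i; rewrite /u /pshift comp_polyZ -scalerBr coefZ mulrC.
  congr (_ * _); have [p sp] := pshift_Xn (- c) n.+1; rewrite /pshift => ->.
  rewrite coefB !coefD coefZ !coefXn eqxx ltn_eqF // [p`__]nth_default //.
  by rewrite add0r addr0 subr0 mulr1 mulrN.
rewrite /leading /path_sum /= -hornerZ -path_polyZ.
by congr (path_poly _ _ _).[_]; apply/funext => i; rewrite scalerA.
Qed.

Lemma path_poly_gen xi q i : path_poly xi q (gen i) = q i.
Proof. by rewrite -[gen i]mulg1 path_poly_genM path_poly1 pshift0p addr0. Qed.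

Lemma leading_comm_gen i j z :
  leading 1 [~ gen i, gen j]%g z = z.1 i * z.2 j - z.1 j * z.2 i.
Proof.
rewrite /leading /path_sum /commg /conjg !path_polyM !path_polyV !heightV.
rewrite !path_poly_gen !height_gen !(hornerD, hornerN, horner_pshift) expr1.
by rewrite ?hornerZ ?hornerX; ring.
Qed.

End Depth.

(** * The span of the leading terms *)

Section LeadingSpan.
Variables (C : numFieldType) (r : nat).
Notation F := (free_group 'I_r).
Notation Z := (('I_r -> C) * ('I_r -> C))%type.
Notation V := (Z -> C^o).
Local Open Scope ring_scope.

Inductive lspan (P : V -> Prop) : V -> Prop :=
| lspan0 : lspan P 0
| lspan_cons a u v : P u -> lspan P v -> lspan P (a *: u + v).

Lemma lspan_lin P a u v : lspan P u -> lspan P v -> lspan P (a *: u + v).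
Proof.
move=> + Pv; elim=> [|b w x Pw _ IHx]; first by rewrite scaler0 add0r.
by rewrite scalerDr -addrA scalerA; apply: lspan_cons.
Qed.

Lemma lspanD P u v : lspan P u -> lspan P v -> lspan P (u + v).
Proof. by move=> Pu Pv; rewrite -[u]scale1r; apply: lspan_lin. Qed.

Lemma lspanZ P a u : lspan P u -> lspan P (a *: u).
Proof. by move=> Pu; rewrite -[_ *: u]addr0; apply: lspan_lin => //; apply: lspan0. Qed.

Lemma lspanB P u v : lspan P u -> lspan P v -> lspan P (u - v).
Proof. by move=> Pu Pv; rewrite -scaleN1r addrC; apply: lspan_lin. Qed.

Lemma mem_lspan (P : V -> Prop) u : P u -> lspan P u.
Proof. by move=> Pu; rewrite -[u]scale1r -[_ *: u]addr0; apply/lspan_cons/lspan0. Qed.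

Lemma lspan_sum P I s (Q : pred I) (f : I -> V) :
  (forall i, Q i -> lspan P (f i)) -> lspan P (\sum_(i <- s | Q i) f i).
Proof.
move=> Pf; elim/big_rec: _ => [|i v Qi Pv]; first exact: lspan0.
exact/lspanD/Pv/Pf.
Qed.

Lemma lspan_linear P Q (g : V -> V) : g 0 = 0 ->
  (forall a u v, g (a *: u + v) = a *: g u + g v) ->
  (forall u, P u -> lspan Q (g u)) -> forall u, lspan P u -> lspan Q (g u).
Proof.
move=> g0 gP gPQ u; elim=> [|a v w Pv _ IHw]; first by rewrite g0; apply: lspan0.
by rewrite gP; apply: lspan_lin => //; apply: gPQ.
Qed.

Lemma lspan_mono (P Q : V -> Prop) : (forall u, P u -> Q u) ->
  forall u, lspan P u -> lspan Q u.
Proof. by move=> PQ u; apply: (lspan_linear (g := id)) => // v /PQ /mem_lspan. Qed.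

Definition coord (i : 'I_r) : V := fun z => z.1 i.
Definition lin (y : 'I_r -> C) : V := fun z => \sum_i y i * z.1 i.
Definition lin2 (y : 'I_r -> C) : V := fun z => \sum_i y i * z.2 i.

(** The pointwise product, since [C^o]-valued functions are used as a vector
space only. *)
Definition fmul (u v : V) : V := fun z => (u z : C) * (v z : C).

Lemma fmulPr u a v w : fmul u (a *: v + w) = a *: fmul u v + fmul u w.
Proof.
apply/funext => z.
change ((u z : C) * (a * v z + w z) = a * (u z * v z) + u z * w z).
by rewrite mulrDr mulrCA.
Qed.
Lemma fmul0r u : fmul u 0 = 0.
Proof. by apply/funext => z; rewrite /fmul mulr0. Qed.
Lemma fmulPl u a v w : fmul (a *: v + w) u = a *: fmul v u + fmul w u.
Proof.
apply/funext => z.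
change ((a * v z + w z) * (u z : C) = a * (v z * u z) + w z * u z).
by rewrite mulrDl mulrA.
Qed.
Lemma fmul0l u : fmul 0 u = 0.
Proof. by apply/funext => z; rewrite /fmul mul0r. Qed.

Lemma lspan_fmul P Q R : (forall u v, P u -> Q v -> lspan R (fmul u v)) ->
  forall u v, lspan P u -> lspan Q v -> lspan R (fmul u v).
Proof.
move=> PQR u v Pu Qv.
apply: (lspan_linear (g := fmul^~ v) _ _ _ Pu); first exact: fmul0l.
  by move=> a u1 u2; apply: fmulPl.
move=> u' Pu'; apply: (lspan_linear (g := fmul u') _ _ _ Qv); first exact: fmul0r.
  by move=> a u1 u2; apply: fmulPr.
by move=> v' Qv'; apply: PQR.
Qed.

(** The products of [n] coordinates of [xi] and one of [eta]; they are finitely many,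
which makes [top_space n] finite-dimensional. *)
Fixpoint monom n (v : V) : Prop :=
  if n is n'.+1 then exists i u, monom n' u /\ v = fmul (coord i) u
  else exists i, v = (fun z => z.2 i).

Lemma monom_span n : exists m (b : 'I_m -> V), forall v, lspan (monom n) v -> in_span b v.
Proof.
have span_lin m (b : 'I_m -> V) P : (forall v, P v -> in_span b v) ->
    forall v, lspan P v -> in_span b v.
  move=> Pb v; elim=> [|a u w /Pb[x ->] _ [y ->]].
    by exists 0; rewrite big1 // => i _; rewrite mxE scale0r.
  exists (a *: x + y); rewrite scaler_sumr -big_split; apply: eq_bigr => i _ /=.
  by rewrite !mxE scalerDl scalerA.
have mem_b m (b : 'I_m -> V) i : in_span b (b i).
  exists (delta_mx 0 i); rewrite (bigD1 i) //= mxE !eqxx scale1r big1 ?addr0 // => j ji.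
  by rewrite mxE (negPf ji) andbF scale0r.
elim: n => [|n [m [b bE]]].
  exists r, (fun i z => z.2 i); apply: span_lin => _ [i ->].
  exact: (mem_b _ (fun i z => z.2 i) i).
pose b' (k : 'I_(r * m)) := fmul (coord (mxtens_unindex k).1) (b (mxtens_unindex k).2).
exists (r * m)%N, b'; apply: (span_lin) => _ [i [u [mu ->]]].
have [x ->] := bE _ (mem_lspan mu).
apply: (span_lin _ _ (fun v => exists k, v = b' k)) => [_ [k ->]//|].
apply: (lspan_fmul _ (P := eq (coord i)) (Q := fun v => exists j, v = b j)).
- move=> _ _ <- [j ->]; apply: mem_lspan; exists (mxtens_index (i, j)).
  by rewrite /b' mxtens_indexK.
- exact: mem_lspan.
- by apply: lspan_sum => j _; apply/lspanZ/mem_lspan; exists j.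
Qed.

(** The sum is followed with an arbitrary starting height [height xi y], because
the induction on the word moves that point. *)
Lemma leading_monom n (x : F) : lspan (monom n) (@leading C r n x).
Proof.
have hpow k (y : F) v : lspan (monom 0) v ->
    lspan (monom k) (fun z => (height z.1 y) ^+ k * v z).
  move=> v0; elim: k => [|k IHk].
    by rewrite (_ : (fun _ => _) = v) //; apply/funext => z; rewrite expr0 mul1r.
  have -> : (fun z => (height z.1 y) ^+ k.+1 * v z) =
    fmul (fun z => height z.1 y) (fun z => (height z.1 y) ^+ k * v z) :> V.
    by apply/funext => z; rewrite exprS /fmul mulrA.
  apply: (lspan_fmul _ (P := fun u => exists i, u = coord i)) IHk => [_ u [i ->] mu|].
    by apply: mem_lspan; exists i, u.
  have -> : (fun z => height z.1 y) = \sum_i (abel y 0 i)%:~R *: coord i :> V.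
    apply/funext => z; rewrite fct_sumE; apply: eq_bigr => i _.
    by rewrite fctE /= mulrC.
  by apply: lspan_sum => i _; apply/lspanZ/mem_lspan; exists i.
pose g (y : F) : V := fun z => (path_poly z.1 (fun i => z.2 i *: 'X^n) x).[height z.1 y].
suff : forall y, lspan (monom n) (g y).
  move=> /(_ 1%g); congr lspan; apply/funext => z.
  by rewrite /g /leading /path_sum height1.
rewrite /g {g}; elim/free_group_ind: x => [|i x IHx|i x IHx] y.
- rewrite (_ : (fun _ => _) = 0); first exact: lspan0.
  by apply/funext => z; rewrite path_poly1 horner0.
- rewrite (_ : (fun _ => _) = (fun z => (height z.1 y) ^+ n * z.2 i) +
    (fun z => (path_poly z.1 (fun i => z.2 i *: 'X^n) x).[height z.1 (y * gen i)%g]) :> V).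
    by apply: lspanD => //; apply: hpow; apply: mem_lspan; exists i.
  apply/funext => z; rewrite path_poly_genM hornerD hornerZ hornerXn horner_pshift.
  by rewrite -[RHS]/(_ ^+ _ * _ + _.[_]) mulrC heightM height_gen.
- rewrite (_ : (fun _ => _) =
    (fun z => (path_poly z.1 (fun i => z.2 i *: 'X^n) x).[height z.1 (y * (gen i)^-1)%g]) -
    (fun z => (height z.1 (y * (gen i)^-1)%g) ^+ n * z.2 i) :> V).
    by apply: lspanB => //; apply: hpow; apply: mem_lspan; exists i.
  apply/funext => z; rewrite path_poly_genVM horner_pshift hornerD hornerN hornerZ hornerXn.
  by rewrite -[RHS]/(_.[_] - _ ^+ _ * _) heightM heightV height_gen mulrC.
Qed.

Definition top_space n : V -> Prop :=
  lspan (fun v => exists2 x : F, deep C n x & v = leading n x).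

Lemma top_space_monom n v : top_space n v -> lspan (monom n) v.
Proof.
apply: (lspan_linear (g := id)) => // _ [x _ ->]; exact: leading_monom.
Qed.

(** The leading term of the commutator of two vectors of the abelianization,
extended to complex coefficients. *)
Definition alt (y1 y2 : 'I_r -> C) : V :=
  fun z => lin y1 z * lin2 y2 z - lin y2 z * lin2 y1 z.

Lemma top_space_alt y1 y2 : top_space 1 (alt y1 y2).
Proof.
have -> : alt y1 y2 = \sum_i \sum_j (y1 i * y2 j) *: leading 1 [~ gen i, gen j]%g.
  apply/funext => z; rewrite /alt /lin /lin2 fct_sumE big_distrlr /= mulrC.
  rewrite big_distrlr /= -sumrB; apply: eq_bigr => i _.
  rewrite fct_sumE -sumrB; apply: eq_bigr => j _.
  rewrite -[RHS]/(_ * leading _ _ _) leading_comm_gen; ring.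
apply: lspan_sum => i _; apply: lspan_sum => j _; apply/lspanZ/mem_lspan.
exists [~ gen i, gen j]%g => //; apply: deep_comm; exact: deep0.
Qed.

(** Commutators with generators multiply leading terms by the coordinates of [xi];
by linearity the product with any complex linear form stays in the span. *)
Lemma top_space_lin n y v : top_space n.+1 v -> top_space n.+2 (fmul (lin y) v).
Proof.
have -> : lin y = \sum_i y i *: coord i.
  by apply/funext => z; rewrite /lin fct_sumE.
apply: (lspan_fmul _ (P := fun u => exists i, u = coord i)); last first.
  by apply: lspan_sum => i _; apply/lspanZ/mem_lspan; exists i.
move=> _ _ [i ->] [x dx ->].
have -> : fmul (coord i) (leading n.+1 x) =
    (- n.+2%:R^-1) *: leading n.+2 [~ x, gen i]%g.
  apply/funext => z; rewrite fctE leading_comm // height_gen /fmul /coord.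
  rewrite -[RHS]/(_ * _) mulrA mulrNN mulrA mulVf ?mul1r // pnatr_eq0 //.
by apply/lspanZ/mem_lspan; exists [~ x, gen i]%g => //; exact: deep_comm.
Qed.

End LeadingSpan.

(** * Finitely many classes forbid fixed leading terms *)

Section InvariantTop.
Variables (C : numFieldType) (r : nat).
Notation F := (free_group 'I_r).
Notation Z := (('I_r -> C) * ('I_r -> C))%type.
Notation V := (Z -> C^o).
Local Open Scope ring_scope.
Variables (f : F -> F) (fM : {morph f : x y / (x * y)%g}).

Definition no_fixed (P : V -> Prop) := forall v, P v -> v \o pull f = v -> v = 0.

Lemma comp_pull0 : (0 : V) \o pull f = 0. Proof. by []. Qed.

Lemma no_fixedP n P : (forall v, lspan P v -> lspan (monom n) v) ->
  (forall v, P v -> lspan P (v \o pull f)) ->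
  no_fixed (lspan P) <->
  forall v, lspan P v -> exists2 w, lspan P w & w \o pull f - w = v.
Proof.
move=> Pn Pf; have [m [b bE]] := @monom_span C r n.
pose g (v : V) : V := v \o pull f - v.
have gP a u v : g (a *: u + v) = a *: g u + g v.
  by rewrite /g scalerBr opprD addrACA.
have pullS v : lspan P v -> lspan P (v \o pull f).
  by apply: (lspan_linear (g := fun v => v \o pull f)).
have [] := @stable_inj_surj _ _ (lspan P) (lspan0 _) (@lspan_lin _ _ P) g gP _ m b.
- by move=> v Pv; apply: lspanB => //; apply: pullS.
- by move=> v /Pn/bE.
move=> injS surjI; split.
  move=> nf; apply: injS => v Pv /eqP; rewrite subr_eq0 => /eqP; exact: nf.
by move=> sg v Pv vf; apply: (surjI sg) => //; rewrite /g vf subrr.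
Qed.

Lemma top_space_pull n (v : V) : top_space n v -> top_space n (v \o pull f).
Proof.
apply: (lspan_linear (g := fun v : V => v \o pull f)) => // _ [x dx ->].
by apply: mem_lspan; exists (f x); [exact: deep_morph|rewrite leading_morph].
Qed.

(** The hypothesis is what finiteness of the Reidemeister number yields by the
pigeonhole principle on the powers of [x].  With no fixed leading terms below
[n], the element [z] that links [x ^+ a] to [x ^+ b] is deep enough to have a
leading term in degree [n], and comparing leading terms puts [(a - b)] times that
of [x] in the image of [1 - f].  So [1 - f] is onto, hence injective. *)
Lemma no_fixed_top m :
  (forall x : F, exists a b z y, [/\ (a < b)%N, deep C m y &
     (x ^+ a = z * x ^+ b * (f z)^-1 * y)%g]) ->
  forall n, (n < m)%N -> no_fixed (@top_space C r n).
Proof.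
move=> fin n; elim/ltn_ind: n => n IHn lt_nm.
pose P (v : V) := exists2 x : F, deep C n x & v = leading n x.
have [|_ surjI] := @no_fixedP n P (@top_space_monom C r n) => [_ [x dx ->]|].
  by apply: top_space_pull; apply: mem_lspan; exists x.
apply: surjI.
move=> v; elim=> [|k _ w [x dx ->] _ [w' w'S w'E]].
  by exists 0; [exact: lspan0|rewrite comp_pull0 subrr].
suff [u uS uE] : exists2 u : V, top_space n u & u \o pull f - u = leading n x.
  exists (k *: u + w'); first exact: lspan_lin.
  by rewrite -uE -w'E scalerBr opprD addrACA.
have [a [b [z [y [lt_ab dy xE]]]]] := fin x.
have dV := fun j => @deep_subgroup C r j.
have dX j k' : (j <= n)%N -> deep C j (x ^+ k')%g.
  by move=> le_jn; apply: deep_le le_jn _; apply: deepX.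
have dfzV j : deep C j z -> deep C j (f z)^-1%g.
  by move=> dz; rewrite -[_^-1%g]mul1g; apply: (dV j).2; [exact: (dV j).1|exact: deep_morph].
have eqL j : (j <= n)%N -> deep C j z ->
    @leading C r j (x ^+ a)%g = leading j z + leading j (x ^+ b)%g - (leading j z \o pull f).
  move=> le_jn dz; have dyj : deep C j.+1 y by apply: deep_le dy; apply: leq_ltn_trans lt_nm.
  rewrite xE leadingM; last exact: deep_le (leqnSn j) dyj.
  rewrite (leading_deep dyj) addr0 leadingM; last exact: dfzV.
  rewrite leadingM; last exact: dX.
  by rewrite leadingV ?leading_morph //; exact: deep_morph.
(* below n, the leading term of z would be fixed *)
have dz j : (j <= n)%N -> deep C j z.
  elim: j => [|j IHj] lt_jn; first exact: deep0.
  have dzj := IHj (ltnW lt_jn); apply: deepS => //.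
  apply: (IHn j lt_jn (ltn_trans lt_jn lt_nm)); first by apply: mem_lspan; exists z.
  have := eqL j (ltnW lt_jn) dzj; rewrite !(leading_deep (dX _ _ lt_jn)).
  by rewrite addr0 => /eqP; rewrite eq_sym subr_eq0 => /eqP.
have := eqL n (leqnn n) ((dz) n (leqnn n)); rewrite !leadingX // => xzE.
exists ((a%:R - b%:R)^-1 *: - leading n z).
  by apply/lspanZ; rewrite -scaleN1r; apply/lspanZ/mem_lspan; exists z => //; exact: dz.
have ab0 : (a%:R - b%:R : C) != 0 by rewrite subr_eq0 eqr_nat ltn_eqF.
have -> : ((a%:R - b%:R)^-1 *: - leading n z : V) \o pull f =
  (a%:R - b%:R)^-1 *: ((- leading n z) \o pull f) by [].
rewrite -scalerBr; apply: (scalerI ab0); rewrite scalerA mulfV // scale1r scalerBl xzE.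
by rewrite opprK [RHS]addrAC addrK [RHS]addrC.
Qed.

End InvariantTop.

(** * A fixed vector of weight (2, ..., 2) *)

Section Flag.
Variables (C : numClosedFieldType) (s : nat).
Notation r := s.+2.
Notation F := (free_group 'I_r).
Notation Z := (('I_r -> C) * ('I_r -> C))%type.
Notation V := (Z -> C^o).
Local Open Scope ring_scope.
Variables (f : F -> F) (fM : {morph f : x y / (x * y)%g}).
Variables (P T : 'M[C]_r).
Hypotheses (uP : P \in unitmx) (tT : is_trig_mx T).
Hypothesis PT : P *m map_mx intr (abel_mx f) = T *m P.

Definition flag (i : 'I_r) : V := lin (fun l => P i l).
Definition flag2 (i : 'I_r) : V := lin2 (fun l => P i l).

Let pairing_pull (w : 'I_r -> C) i :
  \sum_l P i l * height w (f (gen l)) = \sum_j T i j * \sum_l P j l * w l.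
Proof.
pose wv : 'cV[C]_r := \col_l w l.
transitivity ((P *m map_mx intr (abel_mx f) *m wv) i 0).
  rewrite -mulmxA mxE; apply: eq_bigr => l _; congr (_ * _).
  by rewrite mxE; apply: eq_bigr => j _; rewrite !mxE mulrC.
rewrite PT -mulmxA mxE; apply: eq_bigr => j _; congr (_ * _).
by rewrite mxE; apply: eq_bigr => l _; rewrite mxE.
Qed.

Lemma flag_pull i : flag i \o pull f = \sum_j T i j *: flag j.
Proof. by apply/funext => z; rewrite fct_sumE; exact: pairing_pull. Qed.

(** Up to scalars, left-normed commutators of flag vectors have leading terms
[falt i j * ftail J]: the first two entries enter alternately, the others
symmetrically.  The weight of such a commutator is the sum of its indices. *)
Definition ftail (J : seq 'I_r) : V := fun z => \prod_(j <- J) (flag j z : C).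

Definition weight (J : seq 'I_r) : nat := \sum_(j <- J) j.

Definition tail_space n w : V -> Prop :=
  lspan (fun v => exists J, [/\ size J = n, (weight J < w)%N & v = ftail J]).

Lemma tail_space_mem J w : (weight J < w)%N -> tail_space (size J) w (ftail J).
Proof. by move=> lt_w; apply: mem_lspan; exists J. Qed.

Lemma tail_space_mono n w w' (v : V) : (w <= w')%N -> tail_space n w v -> tail_space n w' v.
Proof.
move=> le_w; apply: lspan_mono => _ [J [sJ wJ ->]]; exists J; split=> //.
exact: leq_trans le_w.
Qed.

Lemma ftail_cons k J : ftail (k :: J) = fmul (flag k) (ftail J).
Proof. by apply/funext => z; rewrite /ftail big_cons. Qed.

Lemma tail_space_mul n w (k : 'I_r) (v : V) :
  tail_space n w v -> tail_space n.+1 (k + w) (fmul (flag k) v).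
Proof.
apply: (lspan_linear (g := fmul (flag k))) => [||_ [J [sJ wJ ->]]].
- exact: fmul0r.
- by move=> a u u'; apply: fmulPr.
- apply: mem_lspan; exists (k :: J); split; rewrite /= ?sJ ?ftail_cons //.
  by rewrite /weight big_cons ltn_add2l.
Qed.

Lemma fmul_suml (I : finType) (Q : pred I) (u : I -> V) (v : V) :
  fmul (\sum_(i | Q i) u i) v = \sum_(i | Q i) fmul (u i) v.
Proof.
elim/big_rec2: _ => [|i x y _ <-]; first exact: fmul0l.
by have := fmulPl v 1 (u i) y; rewrite !scale1r => ->.
Qed.

Lemma fmulZl a (u v : V) : fmul (a *: u) v = a *: fmul u v.
Proof. by rewrite -[a *: u]addr0 fmulPl fmul0l addr0. Qed.

Lemma fmulZr a (u v : V) : fmul u (a *: v) = a *: fmul u v.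
Proof. by rewrite -[a *: v]addr0 fmulPr fmul0r addr0. Qed.

Lemma fmulBr (u v v' : V) : fmul u (v - v') = fmul u v - fmul u v'.
Proof. by rewrite addrC -scaleN1r fmulPr scaleN1r addrC. Qed.

Lemma fmulBl (u u' v : V) : fmul (u - u') v = fmul u v - fmul u' v.
Proof. by rewrite addrC -scaleN1r fmulPl scaleN1r addrC. Qed.

Lemma trig_sum k (u : 'I_r -> V) : \sum_j T k j *: u j =
  \sum_(j < r | (j < k)%N) T k j *: u j + T k k *: u k.
Proof.
rewrite (bigD1 k) //= addrC; congr (_ + _).
rewrite (bigID (fun j : 'I_r => (j < k)%N)) /= [X in _ + X]big1 => [|j].
  rewrite addr0; apply: eq_bigl => j; rewrite -val_eqE /=.
  by case: ltngtP.
rewrite -leqNgt -val_eqE /= => /andP[jk le_kj].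
by rewrite (is_trig_mxP tT) ?scale0r // ltn_neqAle eq_sym jk.
Qed.

(** The eigenvalue of [ftail J] modulo lower weight. *)
Definition diagT (J : seq 'I_r) : C := \prod_(j <- J) T j j.

(** Substituting [A] replaces each flag vector by its multiple under the diagonal
entry plus flag vectors of smaller index. *)
Lemma tail_pull J :
  tail_space (size J) (weight J) (ftail J \o pull f - diagT J *: ftail J).
Proof.
elim: J => [|k J IHJ].
  rewrite (_ : _ - _ = 0); first exact: lspan0.
  have -> : ftail [::] = (fun=> 1) by apply/funext => z; rewrite /ftail big_nil.
  by rewrite /diagT big_nil scale1r; apply: subrr.
set tp := ftail J \o pull f.
have tpS : tail_space (size J) (weight J).+1 tp.
  rewrite /tp -[ftail J \o _](subrK (diagT J *: ftail J)); apply: lspanD.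
    exact: tail_space_mono IHJ.
  by apply/lspanZ/tail_space_mem.
have -> : ftail (k :: J) \o pull f - diagT (k :: J) *: ftail (k :: J) =
    \sum_(j < r | (j < k)%N) T k j *: fmul (flag j) tp +
    T k k *: fmul (flag k) (tp - diagT J *: ftail J).
  have -> : ftail (k :: J) \o pull f = fmul (flag k \o pull f) tp.
    by rewrite ftail_cons.
  rewrite flag_pull fmul_suml (eq_bigr (fun j => T k j *: fmul (flag j) tp)).
    rewrite trig_sum -addrA fmulBr fmulZr scalerBr scalerA; congr (_ + (_ - _ *: _)).
      by rewrite /diagT big_cons.
    exact: ftail_cons.
  by move=> j _; rewrite fmulZl.
apply: lspanD.
  apply: lspan_sum => j lt_jk; apply/lspanZ.
  apply: tail_space_mono (tail_space_mul j tpS); rewrite /weight big_cons.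
  by rewrite addnS -addSn leq_add2r.
by apply: lspanZ; rewrite /weight big_cons; apply: tail_space_mul.
Qed.

Definition falt (i j : 'I_r) : V := alt (fun l => P i l) (fun l => P j l).

Definition wedge_space n w : V -> Prop :=
  lspan (fun v => exists (i j : 'I_r) J, [/\ size J = n, (i + j + weight J < w)%N
                                 & v = fmul (falt i j) (ftail J)]).

Definition low_alt w : V -> Prop :=
  lspan (fun v => exists i j : 'I_r, (i + j < w)%N /\ v = falt i j).

Lemma low_alt_mul n w w' (u v : V) : low_alt w u -> tail_space n w'.+1 v ->
  wedge_space n (w + w') (fmul u v).
Proof.
move=> lu tv; apply: (lspan_fmul _ lu tv) => _ _ [i [j [ij ->]]] [J [sJ wJ ->]].
apply: mem_lspan; exists i, j, J; split=> //.
by rewrite -addSn leq_add.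
Qed.

Lemma alt_mul n w (i j : 'I_r) (v : V) : tail_space n w v ->
  wedge_space n (i + j + w) (fmul (falt i j) v).
Proof.
apply: (lspan_linear (g := fmul (falt i j))) => [||_ [J [sJ wJ ->]]].
- exact: fmul0r.
- by move=> a u u'; apply: fmulPr.
- by apply: mem_lspan; exists i, j, J; rewrite ltn_add2l.
Qed.

Lemma alt_pull (i j : 'I_r) :
  low_alt (i + j) (falt i j \o pull f - (T i i * T j j) *: falt i j).
Proof.
have -> : falt i j \o pull f = \sum_k \sum_l (T i k * T j l) *: falt k l.
  have fE k z : flag k (pull f z) = \sum_j T k j * flag j z :> C by exact: pairing_pull.
  have f2E k z : flag2 k (pull f z) = \sum_j T k j * flag2 j z :> C by exact: pairing_pull.
  apply/funext => z; rewrite fct_sumE.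
  transitivity (flag i (pull f z) * flag2 j (pull f z) -
                flag j (pull f z) * flag2 i (pull f z) : C) => //.
  rewrite !fE !f2E big_distrlr /= [X in _ - X]mulrC big_distrlr /= -sumrB.
  apply: eq_bigr => k _; rewrite fct_sumE -sumrB; apply: eq_bigr => l _.
  rewrite -[RHS]/(_ * (flag k z * flag2 l z - flag l z * flag2 k z)); ring.
have low k l : (k, l) != (i, j) -> low_alt (i + j) ((T i k * T j l) *: falt k l).
  move=> kl; have [ik|ki] := ltnP i k.
    by rewrite (is_trig_mxP tT) // mul0r scale0r; apply: lspan0.
  have [jl|lj] := ltnP j l.
    by rewrite [T j l](is_trig_mxP tT) // mulr0 scale0r; apply: lspan0.
  apply/lspanZ/mem_lspan; exists k, l; split=> //.
  move: kl; rewrite xpair_eqE negb_and -!val_eqE /=.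
  by move=> kl; rewrite ltn_neqAle leq_add // andbT; apply: contraTN kl => /eqP; lia.
rewrite (bigD1 i) //= (bigD1 j) //= -[X in X - _]addrA [X in X - _]addrC addrK.
apply: lspanD; apply: lspan_sum => k ki; last apply: lspan_sum => l _.
  by apply: low; rewrite xpair_eqE (negPf ki) andbF.
by apply: low; rewrite xpair_eqE (negPf ki).
Qed.

Lemma wedge_pull (i j : 'I_r) J : wedge_space (size J) (i + j + weight J)
  (fmul (falt i j) (ftail J) \o pull f -
   (T i i * T j j * diagT J) *: fmul (falt i j) (ftail J)).
Proof.
set tp := ftail J \o pull f.
have tpS : tail_space (size J) (weight J).+1 tp.
  rewrite /tp -[ftail J \o _](subrK (diagT J *: ftail J)); apply: lspanD.
    exact: tail_space_mono (tail_pull J).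
  by apply/lspanZ/tail_space_mem.
have -> : fmul (falt i j) (ftail J) \o pull f -
   (T i i * T j j * diagT J) *: fmul (falt i j) (ftail J) =
   fmul (falt i j \o pull f - (T i i * T j j) *: falt i j) tp +
   (T i i * T j j) *: fmul (falt i j) (tp - diagT J *: ftail J).
  by rewrite (fmulBl (falt i j \o pull f)) fmulZl fmulBr
     [fmul _ (_ *: _)]fmulZr scalerBr scalerA addrA subrK.
apply: lspanD; first exact: low_alt_mul (alt_pull i j) tpS.
exact/lspanZ/alt_mul/tail_pull.
Qed.

Lemma wedge_space_pull n w (v : V) : wedge_space n w v -> wedge_space n w (v \o pull f).
Proof.
apply: (lspan_linear (g := fun v : V => v \o pull f)) => // _ [i [j [J [sJ lt_w ->]]]].
rewrite -[_ \o _](subrK ((T i i * T j j * diagT J) *: fmul (falt i j) (ftail J))).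
apply: lspanD; last by apply/lspanZ/mem_lspan; exists i, j, J.
rewrite -sJ; apply: lspan_mono (wedge_pull i j J) => _ [i' [j' [J' [sJ' lt_w' ->]]]].
by exists i', j', J'; split=> //; exact: ltn_trans lt_w.
Qed.

Lemma wedge_space_top n w (v : V) : wedge_space n w v -> top_space n.+1 v.
Proof.
apply: (lspan_linear (g := id)) => // _ [i [j [J [<- _ ->]]]].
elim: J => [|k J IHJ].
  have -> : fmul (falt i j) (ftail [::]) = falt i j.
    by apply/funext => z; rewrite /fmul /ftail big_nil mulr1.
  exact: top_space_alt.
have -> : fmul (falt i j) (ftail (k :: J)) = fmul (flag k) (fmul (falt i j) (ftail J)).
  by apply/funext => z; rewrite ftail_cons /fmul mulrCA.
exact: top_space_lin.
Qed.

(** On this curve the flag vector of index [i] takes the value [t ^ i], so a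
commutator of weight [w] restricts to a multiple of [t ^ w] and the filtration by
weight becomes the filtration by degree.  The factor [i] in the second component
keeps the alternating part from vanishing. *)
Definition curve (t : C) : Z :=
  (fun l => \sum_i invmx P l i * t ^+ i, fun l => \sum_i invmx P l i * (i%:R * t ^+ i)).

Let curveE (u : 'I_r -> C) i : \sum_l P i l * \sum_k invmx P l k * u k = u i.
Proof.
pose c : 'cV[C]_r := \col_k u k.
transitivity ((P *m (invmx P *m c)) i 0); last by rewrite mulKVmx // mxE.
rewrite mxE; apply: eq_bigr => l _; congr (_ * _).
by rewrite mxE; apply: eq_bigr => k _; rewrite mxE.
Qed.

Lemma flag_curve i t : flag i (curve t) = t ^+ i.
Proof. exact: (curveE (fun i : 'I_r => t ^+ i)). Qed.

Lemma flag2_curve i t : flag2 i (curve t) = i%:R * t ^+ i.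
Proof. exact: (curveE (fun i : 'I_r => i%:R * t ^+ i)). Qed.

Lemma wedge_curve (i j : 'I_r) J t : fmul (falt i j) (ftail J) (curve t) =
  (j%:R - i%:R) * t ^+ (i + j + weight J).
Proof.
have -> : fmul (falt i j) (ftail J) (curve t) =
  (flag i (curve t) * flag2 j (curve t) - flag j (curve t) * flag2 i (curve t)) * t ^+ weight J.
  congr (_ * _); elim: J => [|k J IHJ]; first by rewrite /ftail /weight !big_nil.
  by rewrite ftail_cons /fmul IHJ flag_curve /weight big_cons exprD.
rewrite !flag_curve !flag2_curve !exprD; ring.
Qed.

Lemma wedge_space_curve n w (v : V) : wedge_space n w v ->
  exists2 h : {poly C}, (size h <= w)%N & forall t, v (curve t) = h.[t].
Proof.
elim=> [|a _ u [i [j [J [_ lt_w ->]]]] _ [h sh hE]].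
  by exists 0; rewrite ?size_poly0 // => t; rewrite horner0.
exists ((a * (j%:R - i%:R)) *: 'X^(i + j + weight J) + h).
  rewrite (leq_trans (size_polyD _ _)) // geq_max sh andbT.
  by rewrite (leq_trans (size_scale_leq _ _)) // size_polyXn.
move=> t; rewrite hornerD hornerZ hornerXn -hE -mulrA -wedge_curve //.
Qed.

Lemma poly_eq0_horner (p : {poly C}) : (forall t, p.[t] = 0) -> p = 0.
Proof.
move=> p0; apply: contrapT => /eqP pN0.
have := @max_poly_roots _ p [seq i%:R | i <- iota 0 (size p)] pN0.
rewrite size_map size_iota ltnn => H; suff: false by []; apply: H.
  by apply/allP => _ /mapP[i _ ->]; apply/eqP/p0.
by rewrite map_inj_uniq ?iota_uniq // => i j /eqP; rewrite eqr_nat => /eqP.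
Qed.

(** Take for [v0] the commutator whose entries run twice through the flag.  It is
fixed modulo the stable space of lower weight.  Were there no fixed vectors,
[1 - f] would be onto on that space, [v0] would differ from one of its elements by
a fixed vector, hence belong to it; the degree on [curve] excludes this. *)
Lemma top_space_has_fixed : (\det (abel_mx f)) ^+ 2 = 1 ->
  ~ no_fixed f (@top_space C r (s.+2 + s).+1).
Proof.
move=> det2 nf.
(* every index once, and every index from 2 on once more *)
pose J0 : seq 'I_r := enum 'I_r ++ [seq lift ord0 (lift ord0 k) | k <- enum 'I_s].
have sJ0 : size J0 = (s.+2 + s)%N by rewrite size_cat size_map !size_enum_ord.
pose i0 : 'I_r := lift ord0 ord0; pose j0 : 'I_r := ord0.
pose v0 := fmul (falt i0 j0) (ftail J0).
pose w := (i0 + j0 + weight J0)%N.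
have l1 : T i0 i0 * T j0 j0 * diagT J0 = 1.
  have detT : \prod_i T i i = (\det (abel_mx f))%:~R.
    rewrite -det_trig // -det_map_mx; apply: (mulIf (_ : \det P != 0)).
      by rewrite -unitfE -/(unitmx _).
    by rewrite -det_mulmx -PT det_mulmx mulrC.
  transitivity ((\prod_i T i i) ^+ 2); last by rewrite detT -rmorphXn det2.
  rewrite /diagT big_cat big_map !big_enum /= expr2.
  rewrite [X in _ = _ * X]big_ord_recl [X in _ = _ * (_ * X)]big_ord_recl.
  rewrite /i0 /j0; ring.
have v0top : top_space (s.+2 + s).+1 v0.
  by apply: (@wedge_space_top _ w.+1); apply: mem_lspan; exists i0, j0, J0.
pose Q (v : V) := exists (i j : 'I_r) J, 
  [/\ size J = (s.+2 + s)%N, (i + j + weight J < w)%N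
                                 & v = fmul (falt i j) (ftail J)].
have wtop v : lspan Q v -> top_space (s.+2 + s).+1 v by exact: wedge_space_top.
have [surj _] := @no_fixedP C r f _ Q (fun v wv => top_space_monom (wtop v wv))
  (fun v Qv => wedge_space_pull (mem_lspan Qv)).
have {}surj := surj (fun v wv => nf v (wtop v wv)).
have := wedge_pull i0 j0 J0; rewrite l1 scale1r sJ0 -/v0 => /surj[v1 v1S v1E].
have v01 : v0 = v1.
  apply/eqP; rewrite -subr_eq0; apply/eqP/nf.
    by apply: lspanB => //; exact: wtop.
  have -> : (v0 - v1) \o pull f = (v0 \o pull f) - (v1 \o pull f) by [].
  have -> : v1 \o pull f = v1 + (v0 \o pull f - v0) by rewrite -v1E addrC subrK.
  by rewrite opprD opprB addrCA [_ + (v0 - _)]addrCA addrN addr0 addrC.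
have [h sh hE] := wedge_space_curve v1S.
have : h + 'X^w = 0.
  apply: poly_eq0_horner => t; rewrite hornerD hornerXn -hE -v01 /v0 wedge_curve.
  by rewrite /i0 /j0 /= sub0r mulN1r addNr.
move=> /(congr1 (fun p : {poly C} => p`_w)); rewrite coefD coefXn eqxx coef0.
by rewrite nth_default // add0r => /eqP; rewrite oner_eq0.
Qed.

End Flag.

(** * The factors of the lower central series *)

Section LowerCentralFactor.
Variable G : groupType.
Local Open Scope classical_set_scope.
Local Open Scope group_scope.

Definition lcs n : set G := lower_central n.+1.

Lemma lcs_normal n : is_normal_subgroup (lcs n).
Proof. exact: lower_central_normal. Qed.

Lemma lcsM n x y : lcs n x -> lcs n y -> lcs n (x * y).
Proof. exact: subgroupM (lcs_normal n).1. Qed.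
Lemma lcs1 n : lcs n 1. Proof. exact: (lcs_normal n).1.1. Qed.
Lemma lcsV n x : lcs n x -> lcs n x^-1.
Proof. by move=> Lx; rewrite -div1g; apply: (lcs_normal n).1.2 => //; apply: lcs1. Qed.
Lemma lcsJ n x y : lcs n x -> lcs n (x ^ y).
Proof. exact: (lcs_normal n).2. Qed.

Lemma lcs_comm n x y : lcs n x -> lcs n.+1 [~ x, y].
Proof.
by move=> Lx; apply: sub_gen_smallest; exists x => //; exists y.
Qed.

Lemma lcsW n x : lcs n.+1 x -> lcs n x.
Proof.
move: x; apply: smallest_sub; first exact: (lcs_normal n).1.
by move=> _ [x Lx [y _ <-]]; apply: lcsM; [apply: lcsV|apply: lcsJ].
Qed.

Definition lcs_coset n (x : G) := coset_mod (lower_central_normal G n.+2) x.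

Lemma eq_lcs_coset n x y : lcs_coset n x = lcs_coset n y <-> lcs n.+1 (x^-1 * y).
Proof. exact: eq_coset_mod. Qed.

Lemma lcs_cosetM n x y : lcs_coset n (x * y) = lcs_coset n x * lcs_coset n y.
Proof. exact: gmulfM. Qed.

Lemma lcs_cosetC n x y : lcs n x -> lcs_coset n (x * y) = lcs_coset n (y * x).
Proof.
move=> Lx; apply/esym/eq_lcs_coset; rewrite invgM -mulgA.
exact: lcs_comm.
Qed.

(** The factor [lcs n / lcs n.+1] as a subset of [G / lcs n.+1], with its abelian
group written additively; [symbol n] is the projection, extended by zero outside
[lcs n]. *)
Definition factor n : Type :=
  {a : quotient_group (lower_central_normal G n.+2) |
    `[< exists2 x, lcs n x & lcs_coset n x = a >]}.

HB.instance Definition _ n := Choice.on (factor n).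

Fact factor_subproof n x : lcs n x -> `[< exists2 y, lcs n y & lcs_coset n y = lcs_coset n x >].
Proof. by move=> Lx; apply/asboolP; exists x. Qed.

Definition factor_zero n : factor n := Sub (lcs_coset n 1) (factor_subproof (lcs1 n)).

Definition symbol n (x : G) : factor n := insubd (factor_zero n) (lcs_coset n x).

Lemma val_symbol n x : lcs n x -> val (symbol n x) = lcs_coset n x.
Proof. by move=> Lx; rewrite val_insubd factor_subproof. Qed.

Lemma symbol_surj n (a : factor n) : exists2 x, lcs n x & a = symbol n x.
Proof.
have /asboolP[x Lx xE] := valP a; exists x => //; apply/val_inj.
by rewrite val_symbol.
Qed.

Lemma eq_symbol n x y : lcs n x -> lcs n y ->
  symbol n x = symbol n y <-> lcs n.+1 (x^-1 * y).
Proof.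
move=> Lx Ly; split=> [/(congr1 val)|Lxy].
  by rewrite !val_symbol // => /eq_lcs_coset.
by apply/val_inj; rewrite !val_symbol //; apply/eq_lcs_coset.
Qed.

Definition factor_rep n (a : factor n) : G := coset_repr (val a).

Lemma factor_repP n (a : factor n) : lcs n (factor_rep a) /\ symbol n (factor_rep a) = a.
Proof.
have [x Lx ->] := symbol_surj a; rewrite /factor_rep val_symbol //.
have [y Ly ->] := @repr_coset_mod _ _ (lower_central_normal G n.+2) x.
have Lxy : lcs n (x * y) by apply: lcsM => //; exact: lcsW.
split=> //; apply/eq_symbol => //.
by rewrite invgM mulgVK; exact: lcsV.
Qed.

Definition factor_add n (a b : factor n) := symbol n (factor_rep a * factor_rep b).
Definition factor_opp n (a : factor n) := symbol n (factor_rep a)^-1.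

Lemma factor_addE n x y : lcs n x -> lcs n y ->
  factor_add (symbol n x) (symbol n y) = symbol n (x * y).
Proof.
move=> Lx Ly; have [Lx' xE] := factor_repP (symbol n x).
have [Ly' yE] := factor_repP (symbol n y).
apply/val_inj; rewrite /factor_add !val_symbol ?lcs_cosetM; try exact: lcsM.
by congr (_ * _); rewrite -!val_symbol // ?xE ?yE.
Qed.

Lemma factor_oppE n x : lcs n x -> factor_opp (symbol n x) = symbol n x^-1.
Proof.
move=> Lx; have [Lx' xE] := factor_repP (symbol n x).
apply/val_inj; rewrite /factor_opp !val_symbol; try exact: lcsV.
have cV y : lcs_coset n y^-1 = (lcs_coset n y)^-1.
  by rewrite (gmorphV (@lcs_cosetM n)).
by rewrite !cV; congr (_^-1); rewrite -!val_symbol // xE.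
Qed.

Fact factor_addA n : associative (@factor_add n).
Proof.
move=> a b c; have [x Lx ->] := symbol_surj a; have [y Ly ->] := symbol_surj b.
have [z Lz ->] := symbol_surj c.
by rewrite !factor_addE ?mulgAg //; apply: lcsM.
Qed.
Fact factor_addC n : commutative (@factor_add n).
Proof.
move=> a b; have [x Lx ->] := symbol_surj a; have [y Ly ->] := symbol_surj b.
rewrite !factor_addE //; apply/val_inj; rewrite !val_symbol; try exact: lcsM.
exact: lcs_cosetC.
Qed.
Fact factor_add0 n : left_id (symbol n 1) (@factor_add n).
Proof.
move=> a; have [x Lx ->] := symbol_surj a.
by rewrite factor_addE ?mul1g //; apply: lcs1.
Qed.
Fact factor_addN n : left_inverse (symbol n 1) (@factor_opp n) (@factor_add n).
Proof.
move=> a; have [x Lx ->] := symbol_surj a.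
by rewrite factor_oppE // factor_addE ?mulVg //; apply: lcsV.
Qed.

HB.instance Definition _ n := GRing.isZmodule.Build (factor n)
  (@factor_addA n) (@factor_addC n) (@factor_add0 n) (@factor_addN n).

Lemma symbolM n x y : lcs n x -> lcs n y -> symbol n (x * y) = (symbol n x + symbol n y)%R.
Proof. by move=> Lx Ly; rewrite -factor_addE. Qed.
Lemma symbol1 n : symbol n 1 = 0%R. Proof. by []. Qed.
Lemma symbolV n x : lcs n x -> symbol n x^-1 = (- symbol n x)%R.
Proof. by move=> Lx; rewrite -factor_oppE. Qed.

Lemma symbol_eq0 n x : lcs n x -> symbol n x = 0%R <-> lcs n.+1 x.
Proof.
move=> Lx; rewrite -symbol1; split=> [/eq_symbol|Lx'].
  by move=> /(_ Lx (lcs1 n)); rewrite mulg1 => /lcsV; rewrite invgK.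
by apply/eq_symbol => //; [exact: lcs1|rewrite mulg1; exact: lcsV].
Qed.

(** The commutator pairing of [factor n] with [G]; it is well defined and
biadditive because commutators of [lcs n.+1] lie in [lcs n.+2]. *)
Definition bracket n (a : factor n) (y : G) : factor n.+1 :=
  symbol n.+1 [~ factor_rep a, y].

Lemma commMgJ (x y z : G) : [~ x * y, z] = [~ x, z] ^ y * [~ y, z].
Proof. by rewrite /commg /conjg !invgM !mulgAg !mulgK. Qed.

Lemma commgMJ (x y z : G) : [~ x, y * z] = [~ x, z] * [~ x, y] ^ z.
Proof. by rewrite /commg /conjg !invgM !mulgAg !mulgK. Qed.

Lemma symbolJ n x y : lcs n x -> symbol n (x ^ y) = symbol n x.
Proof.
move=> Lx; apply/esym/eq_symbol => //; first exact: lcsJ.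
exact: lcs_comm.
Qed.

Lemma bracketE n x y : lcs n x -> bracket (symbol n x) y = symbol n.+1 [~ x, y].
Proof.
move=> Lx; rewrite /bracket; have [Lz zE] := factor_repP (symbol n x).
move: (factor_rep _) Lz zE => z Lz /esym/eq_symbol => /(_ Lx Lz) Lxz.
have -> : z = x * (x^-1 * z) by rewrite mulgAg mulgV mul1g.
have Lc : lcs n.+2 [~ x^-1 * z, y] := lcs_comm y Lxz.
have Lxy := lcs_comm y Lx.
rewrite commMgJ symbolM ?symbolJ //; [|exact: lcsJ|exact: lcsW].
by have /symbol_eq0 -> := Lc; [rewrite addr0|exact: lcsW].
Qed.

Lemma bracketDl n (a b : factor n) y : bracket (a + b)%R y = (bracket a y + bracket b y)%R.
Proof.
have [x Lx ->] := symbol_surj a; have [z Lz ->] := symbol_surj b.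
rewrite -symbolM // !bracketE //; last exact: lcsM.
rewrite commMgJ symbolM ?symbolJ //; try exact: lcs_comm.
by apply: lcsJ; apply: lcs_comm.
Qed.

Lemma bracketDr n (a : factor n) y z : bracket a (y * z) = (bracket a y + bracket a z)%R.
Proof.
have [x Lx ->] := symbol_surj a; rewrite !bracketE // commgMJ addrC.
rewrite symbolM ?symbolJ //; try exact: lcs_comm.
by apply: lcsJ; apply: lcs_comm.
Qed.

Lemma bracket_sum n I (s : seq I) (b : I -> factor n) (u : I -> int) y :
  bracket (\sum_(i <- s) b i *~ u i)%R y = (\sum_(i <- s) bracket (b i) y *~ u i)%R.
Proof.
have b0 : bracket (0 : factor n)%R y = 0%R.
  by apply: (addrI (bracket (0 : factor n)%R y)); rewrite -bracketDl !addr0.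
have bN (a : factor n) : bracket (- a)%R y = (- bracket a y)%R.
  by apply/eqP; rewrite -addr_eq0 -bracketDl addNr b0.
have bn (a : factor n) k : bracket (a *+ k)%R y = (bracket a y *+ k)%R.
  by elim: k => [|k IHk]; rewrite ?b0 // !mulrS bracketDl IHk.
have bz (a : factor n) z : bracket (a *~ z)%R y = (bracket a y *~ z)%R.
  by case: z => k; rewrite ?NegzE ?mulrNz -!pmulrn ?bN bn.
elim: s => [|i s IHs]; first by rewrite !big_nil.
by rewrite !big_cons bracketDl IHs bz.
Qed.

Section Endomorphism.
Variables (f : G -> G) (fM : {morph f : x y / x * y}).

Let f1 := gmorph1 fM.
Let fV := gmorphV fM.

Lemma morph_comm x y : f [~ x, y] = [~ f x, f y].
Proof. by rewrite /commg /conjg !fM !fV. Qed.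

Lemma lcs_morph n x : lcs n x -> lcs n (f x).
Proof.
elim: n x => [//|n IHn]; apply: smallest_sub.
  split=> [|x y Lx Ly]; first by rewrite /= f1; exact: lcs1.
  by rewrite /= fM fV; apply: lcsM => //; exact: lcsV.
by move=> _ [x Lx [y _ <-]]; rewrite /= morph_comm; apply: lcs_comm; apply: IHn.
Qed.

Definition factor_map n (a : factor n) : factor n := symbol n (f (factor_rep a)).

Lemma factor_mapE n x : lcs n x -> factor_map (symbol n x) = symbol n (f x).
Proof.
move=> Lx; rewrite /factor_map; have [Lz zE] := factor_repP (symbol n x).
apply/eq_symbol; [exact: lcs_morph|exact: lcs_morph|rewrite -fV -fM].
by apply: (lcs_morph (n := n.+1)); move/eq_symbol: zE; apply.
Qed.

Fact factor_map_additive n : GRing.zmod_morphism (@factor_map n).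
Proof.
move=> a b; have [x Lx ->] := symbol_surj a; have [y Ly ->] := symbol_surj b.
rewrite -symbolV // -symbolM //; last exact: lcsV.
rewrite !factor_mapE //; last by apply: lcsM => //; exact: lcsV.
by rewrite fM fV symbolM ?symbolV //; do ?apply: lcsV; exact: lcs_morph.
Qed.

End Endomorphism.

End LowerCentralFactor.

Lemma big_mxtens (Y : nmodType) m n (u : 'I_(m * n) -> Y) :
  (\sum_k u k = \sum_i \sum_j u (mxtens_index (i, j)))%R.
Proof.
rewrite pair_bigA /= (reindex (@mxtens_index m n)) /=; last first.
  by exists (@mxtens_unindex m n) => k _; rewrite (mxtens_indexK, mxtens_unindexK).
by apply: eq_bigr => -[i j].
Qed.

(** * Twisted classes in free nilpotent quotients *)

Section FreeFactors.
Variable r : nat.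
Notation F := (free_group 'I_r).
Local Open Scope classical_set_scope.
Local Open Scope group_scope.

(** The left-normed commutators of generators, indexed like the basis vectors of
the tensor power of degree [n + 1]. *)
Fixpoint basic_comm n : 'I_(tdim r n) -> F :=
  if n is n'.+1 return 'I_(tdim r n) -> F
  then fun k => [~ basic_comm (mxtens_unindex k).1, gen (mxtens_unindex k).2]
  else @gen 'I_r.

Lemma basic_comm_lcs n k : lcs n (@basic_comm n k).
Proof. by elim: n k => [//|n IHn] k; apply: lcs_comm; apply: IHn. Qed.

Lemma basic_commS n i j :
  @basic_comm n.+1 (mxtens_index (i, j)) = [~ basic_comm i, gen j].
Proof.
rewrite -[LHS]/([~ basic_comm (mxtens_unindex (mxtens_index (i, j))).1,
                   gen (mxtens_unindex (mxtens_index (i, j))).2]).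
by rewrite mxtens_indexK.
Qed.

Definition basic_symbol n k := symbol n (@basic_comm n k).

Lemma basic_symbolS n i j :
  @basic_symbol n.+1 (mxtens_index (i, j)) = bracket (basic_symbol i) (gen j).
Proof.
by rewrite /basic_symbol basic_commS bracketE //; apply: basic_comm_lcs.
Qed.

Lemma symbol0E (x : F) : (symbol 0 x = \sum_j basic_symbol (n := 0) j *~ abel x 0 j)%R.
Proof. by apply: free_additiveE => y z; apply: symbolM. Qed.

Lemma bracket_free n (a : factor F n) (y : F) :
  (bracket a y = \sum_j bracket a (gen j) *~ abel y 0 j)%R.
Proof. by apply: free_additiveE => u v; apply: bracketDr. Qed.

Lemma basic_symbol_span n (a : factor F n) : int_span (@basic_symbol n) a.
Proof.
elim: n a => [|n IHn] a; have [x Lx ->] := symbol_surj a.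
  by rewrite symbol0E; apply: int_span_sum => j; apply: mem_int_span.
suff /(_ x Lx)[_ //] : lcs n.+1 `<=`
    [set y | lcs n.+1 y /\ int_span (@basic_symbol n.+1) (symbol n.+1 y)].
clear a x Lx; apply: smallest_sub.
  split=> [|y z [Ly Yy] [Lz Yz]]; rewrite /=.
    by split; [exact: lcs1|rewrite symbol1; exact: int_span0].
  split; first by apply: lcsM => //; exact: lcsV.
  rewrite symbolM ?symbolV //; last exact: lcsV.
  by apply: int_spanD => //; rewrite -mulrN1z; exact: int_spanMz.
move=> _ [y Ly [z _ <-]]; split; first exact: lcs_comm.
rewrite -bracketE // bracket_free; apply: int_span_sum => j.
have [u ->] := IHn (symbol n y); rewrite bracket_sum; apply: int_span_sum => i.
by rewrite -basic_symbolS; apply: mem_int_span.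
Qed.

Variables (f : F -> F) (fM : {morph f : x y / x * y}).

(** By biadditivity of the pairing, [f] acts on these commutators as the tensor
power of its abelianization acts on basis tensors. *)
Lemma basic_symbol_map n i :
  (factor_map f (@basic_symbol n i) = \sum_j basic_symbol j *~ tpow (abel_mx f) n i j)%R.
Proof.
elim: n i => [|n IHn] i.
  rewrite /basic_symbol factor_mapE // symbol0E; apply: eq_bigr => j _.
  by rewrite mxE.
case: (mxtens_indexP i) => {}i k; rewrite big_mxtens {1}/basic_symbol basic_commS.
rewrite factor_mapE //; last by apply: lcs_comm; apply: basic_comm_lcs.
rewrite morph_comm // -bracketE; last by apply: lcs_morph => //; apply: basic_comm_lcs.
rewrite -factor_mapE //; last exact: basic_comm_lcs.
rewrite -/(basic_symbol i) IHn bracket_sum; apply: eq_bigr => j _.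
rewrite bracket_free mulrz_suml; apply: eq_bigr => l _.
by rewrite basic_symbolS tensmxE -mulrzA mxE mulrC.
Qed.

(** One factor is treated at a time: twisted conjugation by [h] in [lcs c] changes
[g] in [lcs c] by the element of [factor c] that [1 - f] takes at [h], so finitely
many corrections bring [g] into [lcs c.+1]. *)
Lemma finite_twisted_classes c :
  (forall n, (n < c)%N -> (\det (1%:M - tpow (abel_mx f) n) != 0)%R) ->
  exists S : seq F, forall y, exists2 s, s \in S &
    exists z g, lcs c g /\ y = z * (s * g) * (f z)^-1.
Proof.
elim: c => [|c IHc] detf.
  exists [:: 1] => y; exists 1; rewrite ?mem_head //; exists 1, y; split=> //.
  have f1 := gmorph1 fM.
  by rewrite f1 !mul1g divg1.
have [n lt_n|S SP] := IHc; first by apply: detf; exact: ltnW.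
have [T TP] := finite_coker (factor_map_additive fM (n := c))
  (@basic_symbol_span c) (@basic_symbol_map c) (detf c (ltnSn c)).
exists [seq s * factor_rep t | s <- S, t <- T] => y.
have [s sS [z [g [Lg ->]]]] := SP y.
have [t tT [b gE]] := TP (symbol c g).
have [h Lh bE] := symbol_surj b.
have Lfh := lcs_morph fM Lh.
(* conjugation by h^-1 turns s * g into s * k *)
pose k := (h^-1) ^ s * g * f h.
have Lhs : lcs c ((h^-1) ^ s) by apply/lcsJ/lcsV.
have Lhsg : lcs c ((h^-1) ^ s * g) by apply: lcsM.
have Lk : lcs c k by apply: lcsM.
have [Lt tE] := factor_repP t.
have kt : symbol c k = t.
  rewrite /k (symbolM Lhsg Lfh) (symbolM Lhs Lg) symbolJ ?symbolV //; last exact: lcsV.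
  by rewrite gE bE factor_mapE // -addrA subrK addrC addrK.
exists (s * factor_rep t); first by apply/allpairsP; exists (s, t).
exists (z * h), ((factor_rep t)^-1 * k); split.
  by apply/eq_symbol; rewrite ?tE.
have -> : s * factor_rep t * ((factor_rep t)^-1 * k) = s * k.
  by rewrite !mulgAg mulgK.
rewrite /k /conjg fM invgM !mulgAg.
by rewrite !mulgK.
Qed.

End FreeFactors.

(** * Automorphisms that induce companion matrices *)

Section CompanionAutomorphism.
Local Open Scope group_scope.

Definition zpow (G : groupType) (x : G) (z : int) : G :=
  match z with Posz n => x ^+ n | Negz n => x ^- n.+1 end.

Lemma zpow_morph (G H : groupType) (f : G -> H) : {morph f : x y / x * y} ->
  forall x z, f (zpow x z) = zpow (f x) z.
Proof.
by move=> fM x [] n; rewrite /= ?(gmorphV fM) (gmorphX fM).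
Qed.

Lemma zpow_signK (G : groupType) (x : G) (e : bool) :
  zpow (zpow x ((-1) ^+ e)%R) ((-1) ^+ e)%R = x.
Proof. by case: e; rewrite /= ?expr1 //= ?expg1 ?invgK. Qed.

Lemma prod_morph (G H : groupType) (f : G -> H) : {morph f : x y / x * y} ->
  forall n (h : 'I_n -> G), f (\prod_i h i) = \prod_i f (h i).
Proof. by move=> fM n h; exact: (big_morph f fM (gmorph1 fM)). Qed.

(** The automorphism moves each generator to the next one and the last generator
to [x_0 ^ (a 0) * w], where [w] is a word in the other generators; since [a 0] is 1
or -1, the generator [x_0] can be recovered. *)
Variables (s : nat) (a : 'I_s.+1 -> int) (e : bool).
Hypothesis a0 : a ord0 = ((-1) ^+ e)%R.
Notation F := (free_group 'I_s.+1).

Definition tail_word (h : 'I_s -> F) : F := \prod_j zpow (h j) (a (lift ord0 j)).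

Definition companion_img (i : 'I_s.+1) : F :=
  if unlift ord_max i is Some j then gen (lift ord0 j)
  else zpow (gen ord0) (a ord0) * tail_word (fun j => gen (lift ord0 j)).

Definition companion_inv_img (i : 'I_s.+1) : F :=
  if unlift ord0 i is Some j then gen (lift ord_max j)
  else zpow (gen ord_max * (tail_word (fun j => gen (lift ord_max j)))^-1) (a ord0).

Definition companion_aut := free_lift companion_img.
Definition companion_inv := free_lift companion_inv_img.

Lemma companion_autM : {morph companion_aut : x y / x * y}. Proof. exact: gmulfM. Qed.
Lemma companion_invM : {morph companion_inv : x y / x * y}. Proof. exact: gmulfM. Qed.

Lemma companion_aut_lift j : companion_aut (gen (lift ord_max j)) = gen (lift ord0 j).
Proof. by rewrite /companion_aut free_lift_gen /companion_img liftK. Qed.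
Lemma companion_aut_max : companion_aut (gen ord_max) =
  zpow (gen ord0) (a ord0) * tail_word (fun j => gen (lift ord0 j)).
Proof. by rewrite /companion_aut free_lift_gen /companion_img unlift_none. Qed.
Lemma companion_inv_lift j : companion_inv (gen (lift ord0 j)) = gen (lift ord_max j).
Proof. by rewrite /companion_inv free_lift_gen /companion_inv_img liftK. Qed.
Lemma companion_inv_0 : companion_inv (gen ord0) =
  zpow (gen ord_max * (tail_word (fun j => gen (lift ord_max j)))^-1) (a ord0).
Proof. by rewrite /companion_inv free_lift_gen /companion_inv_img unlift_none. Qed.

Lemma tail_word_morph (f : F -> F) h : {morph f : x y / x * y} ->
  f (tail_word h) = tail_word (f \o h).
Proof.
by move=> fM; rewrite prod_morph //; apply: eq_bigr => j _; rewrite zpow_morph.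
Qed.

Lemma companion_autK : cancel companion_aut companion_inv.
Proof.
apply: (@eq_free_morph _ _ (companion_inv \o companion_aut) id) => [x y|//|i] /=.
  by rewrite companion_autM companion_invM.
case: (unliftP ord_max i) => [j|] ->; first by rewrite companion_aut_lift companion_inv_lift.
rewrite companion_aut_max companion_invM (zpow_morph companion_invM) companion_inv_0
  a0 zpow_signK.
rewrite (tail_word_morph _ companion_invM)
  (_ : _ \o _ = fun j => gen (lift ord_max j)) ?mulgVK //.
by apply/funext => j; exact: companion_inv_lift.
Qed.

Lemma companion_invK : cancel companion_inv companion_aut.
Proof.
apply: (@eq_free_morph _ _ (companion_aut \o companion_inv) id) => [x y|//|i] /=.
  by rewrite companion_invM companion_autM.
case: (unliftP ord0 i) => [j|] ->; first by rewrite companion_inv_lift companion_aut_lift.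
rewrite companion_inv_0 (zpow_morph companion_autM) companion_autM companion_aut_max
  (gmorphV companion_autM).
rewrite (tail_word_morph _ companion_autM) (_ : _ \o _ = fun j => gen (lift ord0 j)); last first.
  by apply/funext => j; exact: companion_aut_lift.
by rewrite mulgK a0 zpow_signK.
Qed.

Lemma abel_zpow (x : F) z : abel (zpow x z) = (abel x *~ z)%R.
Proof.
have abelX n : abel (x ^+ n) = (abel x *+ n)%R.
  by elim: n => [|n IHn]; rewrite ?abel1 // expgS abelM IHn mulrS.
by case: z => n; rewrite /= ?NegzE ?abelV abelX ?mulrNz.
Qed.

Lemma abel_mx_companion : abel_mx companion_aut = companion a.
Proof.
apply/matrixP => i k; rewrite !mxE.
case: (unliftP ord_max i) => [j|] ->.
  rewrite companion_aut_lift abel_gen mxE eqxx /=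
    [lift ord_max j == _]eq_sym (negPf (neq_lift _ _)).
  by rewrite -val_eqE /= /bump [(s <= j)%N]leqNgt ltn_ord.
rewrite eqxx companion_aut_max abelM abel_zpow /tail_word.
rewrite (big_morph (@abel s.+1) (@abelM s.+1) (abel1 s.+1)).
rewrite (eq_bigr (fun j => (delta_mx 0 (lift ord0 j) *~ a (lift ord0 j))%R)); last first.
  by move=> j _; rewrite abel_zpow abel_gen.
rewrite abel_gen -(big_ord_recl _ (fun i => delta_mx 0 i *~ a i)%R).
rewrite summxE (bigD1 k) //= big1 ?addr0 => [|l lk].
  by rewrite -scaler_int intz !mxE !eqxx mulr1.
by rewrite -scaler_int intz !mxE eq_sym (negPf lk) andbF mulr0.
Qed.

End CompanionAutomorphism.

(** * Reidemeister numbers of quotients of a free group *)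

Section QuotientReidemeister.
Local Open Scope classical_set_scope.
Local Open Scope group_scope.

Lemma reidemeister_finiteP (G : groupType) (phi : {multiplicative G -> G}) :
  reidemeister_number phi <> None <-> finite_set (reidemeister_classes phi).
Proof.
rewrite /reidemeister_number; case: asboolP => fin; split=> //.
Qed.

Section Classes.
Variables (G : groupType) (phi : {multiplicative G -> G}).

Let phiM : {morph phi : x y / x * y}. Proof. exact: gmulfM. Qed.
Let phi1 := gmorph1 phiM.
Let phiV := gmorphV phiM.

Lemma reidemeister_equiv_refl x : reidemeister_equiv phi x x.
Proof. by exists 1; rewrite phi1 mul1g divg1. Qed.

Lemma reidemeister_equiv_sym x y :
  reidemeister_equiv phi x y -> reidemeister_equiv phi y x.
Proof. by case=> z ->; exists z^-1; rewrite phiV invgK !mulgAg mulVg mul1g mulgVK. Qed.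

Lemma reidemeister_equiv_trans x y z : reidemeister_equiv phi x y ->
  reidemeister_equiv phi y z -> reidemeister_equiv phi x z.
Proof.
by case=> u -> [v ->]; exists (u * v); rewrite gmulfM invgM !mulgAg.
Qed.

Lemma reidemeister_class_eq x y : [set u | reidemeister_equiv phi u x] =
  [set u | reidemeister_equiv phi u y] <-> reidemeister_equiv phi x y.
Proof.
split=> [/seteqP[+ _]|xy]; first by apply; exact: reidemeister_equiv_refl.
apply/seteqP; split=> u ux; first exact: reidemeister_equiv_trans xy.
exact: reidemeister_equiv_trans (reidemeister_equiv_sym xy).
Qed.

End Classes.

Variables (s : nat) (N : set (free_group 'I_s.+2)) (nN : is_normal_subgroup N).
Notation F := (free_group 'I_s.+2).
Notation Q := (quotient_group nN).
Notation p := (coset_mod nN).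

Let pM : {morph p : x y / x * y}. Proof. exact: coset_mod_morph. Qed.

Lemma abel_deep (C : numFieldType) (x : F) : deep C 1 x -> abel x = 0%R.
Proof.
move=> dx; apply/rowP => i; have := deep_height (fun j => (j == i)%:R%R) dx.
rewrite /height (bigD1 i) //= eqxx mul1r big1 => [|j /negPf ->]; last by rewrite mul0r.
by rewrite addr0 mxE => /eqP; rewrite intr_eq0 => /eqP.
Qed.

(** Freeness lifts an endomorphism of the quotient; the lift need not be an
automorphism. *)
Lemma lift_quotient (phi : {multiplicative Q -> Q}) :
  exists2 f : F -> F, {morph f : x y / x * y} & forall x, p (f x) = phi (p x).
Proof.
pose f : {multiplicative F -> F} := free_lift (fun i => coset_repr (phi (p (gen i)))).
exists f; first exact: gmulfM.
apply: (@eq_free_morph _ _ (p \o f) (phi \o p)) => [x y|x y|i] /=.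
- by rewrite gmulfM pM.
- by rewrite pM gmulfM.
- by rewrite [f _]free_lift_gen coset_reprK.
Qed.

(** The lifts of the automorphism and of its inverse compose to the identity modulo
[N], hence on the abelianization, so the determinant is 1 or -1. *)
Lemma quotient_R_infinity c : N `<=` deep algC c -> (2 * s.+2 <= c)%N -> R_infinity Q.
Proof.
move=> Nc le_c phi [psi phiK psiK]; apply: contrapT => /reidemeister_finiteP fin.
have psiM : {morph psi : x y / x * y} by exact: can2_gmulfM phiK psiK.
pose psi' : {multiplicative Q -> Q} := HB.pack psi (isMultiplicative.Build Q Q psi psiM).
have [f fM fE] := lift_quotient phi; have [g gM gE] := lift_quotient psi'.
have detf : ((\det (abel_mx f)) ^+ 2 = 1)%R.
  have : (abel_mx g *m abel_mx f = 1%:M)%R.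
    rewrite -abel_mx_comp //; apply/row_matrixP => i; rewrite rowK row1.
    have /eq_coset_mod Ngen : p (gen i) = p ((f \o g) (gen i)) by rewrite /= fE gE psiK.
    have : abel ((gen i)^-1 * (f \o g) (gen i)) = 0%R.
      by apply: (@abel_deep algC); apply: deep_le (Nc _ Ngen); lia.
    by rewrite abelM abelV addrC => /eqP; rewrite subr_eq0 abel_gen => /eqP.
  move=> /(congr1 determinant); rewrite det_mulmx det1 => /(congr1 absz).
  rewrite abszM => /eqP; rewrite muln_eq1 => /andP[_ /eqP d1].
  by rewrite -(real_normK (num_real _)) -abszE d1 expr1n.
have [P [T [uP tT PT]]] :=
  trigonalize (map_mx (intr : int -> algC) (abel_mx f)) (ltn0Sn s.+1).
apply: (top_space_has_fixed uP tT PT detf).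
apply: (no_fixed_top fM (m := 2 * s.+2)); last by lia.
move=> x; pose cl (k : nat) := [set u | reidemeister_equiv phi u (p (x ^+ k))].
have [a [b [lt_ab eq_ab]]] : exists a b, (a < b)%N /\ cl a = cl b.
  apply: contrapT => inj_cl; apply: infinite_nat.
  apply: sub_finite_set (finite_preimage _ fin) => [k _|k l _ _ eq_kl].
    by exists (p (x ^+ k)).
  by case: (ltngtP k l) => // lt_kl; case: inj_cl; [exists k, l|exists l, k].
have [z xE] : reidemeister_equiv phi (p (x ^+ a)) (p (x ^+ b)) by apply/reidemeister_class_eq.
pose w := coset_repr z.
have fV y : p (f y)^-1 = (phi (p y))^-1.
  by rewrite (gmorphV pM) fE.
have /eq_coset_mod Ny : p (w * x ^+ b * (f w)^-1) = p (x ^+ a).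
  by rewrite !pM fV coset_reprK.
exists a, b, w, ((w * x ^+ b * (f w)^-1)^-1 * x ^+ a); split=> //.
  by apply: deep_le (Nc _ Ny).
by rewrite mulgAg mulgV mul1g.
Qed.

Lemma quotient_not_R_infinity c : (c < 2 * s.+2)%N ->
  (lcs c : set F) `<=` N ->
  (forall f : F -> F, {morph f : x y / x * y} -> forall x, N x -> N (f x)) ->
  ~ R_infinity Q.
Proof.
move=> lt_c cN Nchar Rinf.
have [e [a [a0 detA]]] := exists_companion lt_c.
have qmap (f : F -> F) (fM : {morph f : x y / x * y}) :
    exists2 h : Q -> Q, {morph h : x y / x * y} & forall x, h (p x) = p (f x).
  have f1 := gmorph1 fM.
  have fV := gmorphV fM.
  pose h (x : Q) := p (f (coset_repr x)).
  have hE x : h (p x) = p (f x).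
    have [n Nn xn] := repr_coset_mod nN x; apply/esym/eq_coset_mod.
    by rewrite -fV -fM xn mulgAg mulVg mul1g; exact: Nchar.
  exists h => // x y; rewrite -(coset_reprK x) -(coset_reprK y) -pM !hE.
  by rewrite fM pM.
have [h hM hE] := qmap _ (companion_autM a).
have [k kM kE] := qmap _ (companion_invM a).
pose phi : {multiplicative Q -> Q} := HB.pack h (isMultiplicative.Build Q Q h hM).
have phi_bij : bijective phi.
  exists k => x /=; rewrite -(coset_reprK x) (hE, kE) (hE, kE).
    by rewrite (companion_autK a0).
  by rewrite (companion_invK a0).
have [S SP] : exists S : seq F, forall y, exists2 s, s \in S &
    exists z g, lcs c g /\ y = z * (s * g) * (companion_aut a z)^-1.
  apply: finite_twisted_classes; first exact: companion_autM.
  by move=> n lt_n; rewrite abel_mx_companion; exact: detA.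
suff /reidemeister_finiteP : finite_set (reidemeister_classes phi) by apply; exact: Rinf.
pose cl (x : F) := [set u | reidemeister_equiv phi u (p x)].
apply: sub_finite_set (finite_image cl (finite_seq S)) => _ [y _ <-].
have [t tS [z [g [Lg yE]]]] := SP (coset_repr y); exists t => //.
apply/reidemeister_class_eq/reidemeister_equiv_sym; exists (p z).
have pg : p g = 1 by apply/esym/eq_coset_mod; rewrite invg1 mul1g; exact: cN.
have hV : p (companion_aut a z)^-1 = (phi (p z))^-1.
  by rewrite (gmorphV pM) -hE.
by rewrite -(coset_reprK y) yE !pM pg mulg1 hV.
Qed.

End QuotientReidemeister.

Section FreeQuotients.
Local Open Scope classical_set_scope.
Local Open Scope group_scope.

Lemma derived_morph (G : groupType) (f : G -> G) : {morph f : x y / x * y} ->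
  forall n x, derived n x -> derived n (f x).
Proof.
move=> fM; have f1 := gmorph1 fM.
have fV := gmorphV fM.
elim=> [//|n IHn]; apply: smallest_sub.
  have [[d1 dF] _] := derived_normal G n.+1.
  by split=> [|x y dx dy]; rewrite /= ?f1 // fM fV; apply: dF.
move=> _ [x dx [y dy <-]]; rewrite /= morph_comm //.
by apply: sub_gen_smallest; exists (f x); [exact: IHn|exists (f y) => //; exact: IHn].
Qed.

End FreeQuotients.

Theorem theorem2p5 (r c : nat) (hr : 1 < r) (hc : 0 < c) :
  (R_infinity (free_nilpotent r c) <-> 2 * r <= c) /\
  (R_infinity (free_nilpotent_metabelian r c) <-> 2 * r <= c).
Proof.
case: r hr => [|[|s]] // _; split; split.
- move=> Rinf; rewrite leqNgt; apply/negP => lt_c; move: Rinf.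
  apply: (@quotient_not_R_infinity s _ _ c) => //.
  by move=> f fM x; exact: (lcs_morph fM (n := c)).
- apply: quotient_R_infinity; exact: lower_central_deep.
- move=> Rinf; rewrite leqNgt; apply/negP => lt_c; move: Rinf.
  apply: (@quotient_not_R_infinity s _ _ c) => //.
    move=> x Lx; exists x => //; exists 1%g; last exact: mulg1.
    exact: (derived_normal _ 2).1.1.
  move=> f fM _ [x Lx [y dy <-]]; rewrite fM.
  exists (f x); first exact: (lcs_morph fM (n := c)).
  by exists (f y) => //; exact: derived_morph.
- apply: quotient_R_infinity => _ [x Lx [y dy <-]].
  apply: (subgroupM (@deep_subgroup algC s.+2 c)); first exact: lower_central_deep.
  exact: derived2_deep.
Qed.
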